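(* Let $(A,[\cdot,\cdot],\rho)$ be a Lie algebroid, with associated de Rham differential $\mathrm d^A$ and associated multiplicative graded Lie algebra structure $l_2^{[\cdot,\cdot]}$ on the graded vector space $\Gamma(\wedge A)[2]$. Let $(N,\alpha)$ be an $\Omega N$-structure on the Lie algebroid $A$. Then $\underline N+\underline\alpha$ is a Nijenhuis vector valued form with respect to $l_2^{[\cdot,\cdot]}$, with square $\underline{N^2}+\underline{\alpha_N}$.
   Context: $(A,[\cdot,\cdot],\rho)$ is a Lie algebroid over $M$, $\mathrm d^A$ its Chevalley–Eilenberg (de Rham) differential on $\Gamma(\wedge A^* )$. An $\Omega N$-structure on $A$ is a pair $(N,\alpha)$ with $N:\Gamma(A)\to\Gamma(A)$ a $(1,1)$-tensor field ($C^\infty(M)$-linear) and $\alpha\in\Gamma(\wedge^2A^* )$ such that $\alpha_N(X,Y):=\alpha(NX,Y)$ is skew-symmetric (hence a $2$-form on $A$) and $\alpha$ and $\alpha_N$ are $\mathrm d^A$-closed. $\Gamma(\wedge A)[2]$: elements of $\Gamma(\wedge^pA)$ have degree $p-2$. Extensions by derivation: $\underline N(f)=0$ for functions, $\underline N(P_1\wedge\cdots\wedge P_p)=\sum_iP_1\wedge\cdots\wedge N(P_i)\wedge\cdots\wedge P_p$; for a $2$-form $\alpha$, $\underline\alpha$ is the graded symmetric bilinear map of degree $0$ vanishing when an argument is a function and $$\underline\alpha(P,Q)=\sum_{i=1}^p\sum_{j=1}^q(-1)^{q+i+j+1}\alpha(P_i,Q_j)\,\widehat{P_i}\wedge\widehat{Q_j}$$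 for $P=P_1\wedge\cdots\wedge P_p$, $Q=Q_1\wedge\cdots\wedge Q_q$, where $\widehat{P_i}$ is $P$ with the factor $P_i$ omitted (so $\underline\alpha(X,Y)=\alpha(X,Y)$ on sections). The Schouten–Nijenhuis bracket is the unique bilinear bracket on $\Gamma(\wedge A)$ with $[X,f]_{SN}=\rho(X)f$, $[X,Y]_{SN}=[X,Y]$ for $X,Y\in\Gamma(A)$, $[f,g]_{SN}=0$ for functions $f,g$, and for $P\in\Gamma(\wedge^{p}A)$, $Q\in\Gamma(\wedge^qA)$: $[P,Q]_{SN}=-(-1)^{(p-1)(q-1)}[Q,P]_{SN}$, $[P,Q\wedge R]_{SN}=[P,Q]_{SN}\wedge R+(-1)^{(p-1)q}Q\wedge[P,R]_{SN}$. Set $l_2^{[\cdot,\cdot]}(P,Q)=(-1)^{p-1}[P,Q]_{SN}$ for $P\in\Gamma(\wedge^pA)$, a graded symmetric bilinear map of degree $1$. On a graded vector space, a symmetric vector valued $k$-form is a graded symmetric $k$-linear map $K$ (exchanging adjacent arguments $X,Y$ gives $(-1)^{|X||Y|}$), of degree $\bar K$ if $|K(X_1,\dots,X_k)|=\sum|X_i|+\bar K$. For a $k$-form $K$ and $l$-form $L$, $$\iota_KL(X_1,\dots,X_{k+l-1})=\sum_{\sigma\in Sh(k,l-1)}\epsilon(\sigma)L(K(X_{\sigma(1)},\dots,X_{\sigma(k)}),X_{\sigma(k+1)},\dots,X_{\sigma(k+l-1)})$$ (unshuffles, Koszul sign), and $[K,L]_{RN}=\iota_KL-(-1)^{\bar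 K\bar L}\iota_LK$, extended bilinearly. For $\mu$ of degree $1$, $\mathcal N$ of degree $0$ is Nijenhuis with respect to $\mu$ with square $\mathcal K$ if $\mathcal K$ has degree $0$, $[\mathcal N,[\mathcal N,\mu]_{RN}]_{RN}=[\mathcal K,\mu]_{RN}$ and $[\mathcal N,\mathcal K]_{RN}=0$.
   Formalization: The formal theorem adds that the Nijenhuis torsion of N vanishes (necessary: take α=0), and in the extension of a 2-form uses the sign (-1)^{p+i+j+1} instead of (-1)^{q+i+j+1}, since with q the claim fails for N=id and α symplectic on R^4. *)

(* Defs.v *)
From HB Require Import structures.
From mathcomp Require Import all_boot all_order all_algebra.
From mathcomp Require Import all_classical all_reals all_analysis.
From mathcomp Require Import ring.

Set Implicit Arguments.
Unset Strict Implicit.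
Unset Printing Implicit Defensive.

Import Order.TTheory GRing.Theory Num.Theory.
Import numFieldNormedType.Exports.

Local Open Scope classical_set_scope.
Local Open Scope ring_scope.

(** * Smooth functions on open subsets of R^n *)

Section Euclidean.
Context {R : realType} {n : nat}.
Implicit Types (U : set 'rV[R]_n) (f g : 'rV[R]_n -> R).

(* C^k on the open set U, through continuous iterated partial derivatives. *)
Fixpoint Ck (k : nat) U f : Prop :=
  (forall x, U x -> {for x, continuous f}) /\
  if k is k'.+1 then
    forall j : 'I_n, (forall x, U x -> derivable f x (delta_mx 0 j)) /\
                     Ck k' U ('D_(delta_mx 0 j) f)
  else True.

Definition smooth_on U f := forall k, Ck k U f.

Lemma Ck_eq k U f g : open U -> (forall x, U x -> f x = g x) ->
  Ck k U f -> Ck k U g.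
Proof.
elim: k f g => [|k IH] f g oU fg [cf df]; split=> //.
- move=> x Ux; have nfg : \forall y \near x, f y = g y.
    by apply: filterS (open_nbhs_nbhs (conj oU Ux)).
  rewrite /prop_for /continuous_at -(fg _ Ux).
  exact: (cvg_trans (near_eq_cvg nfg) (cf x Ux)).
- move=> x Ux; have nfg : \forall y \near x, f y = g y.
    by apply: filterS (open_nbhs_nbhs (conj oU Ux)).
  rewrite /prop_for /continuous_at -(fg _ Ux).
  exact: (cvg_trans (near_eq_cvg nfg) (cf x Ux)).
- move=> j; have [dfj ck] := df j; split.
    move=> x Ux; apply: near_eq_derivable (dfj x Ux).
    by apply: filterS (open_nbhs_nbhs (conj oU Ux)).
  apply: IH ck => // x Ux; apply: near_eq_derive.
  by apply: filterS (open_nbhs_nbhs (conj oU Ux)).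
Qed.

Lemma Ck_le k U f : Ck k.+1 U f -> Ck k U f.
Proof.
elim: k f => [|k IH] f [cf df]; split=> //.
by move=> j; have [dj cj] := df j; split=> //; apply: IH.
Qed.

Lemma Ck_cst k U (c : R) : Ck k U (fun=> c).
Proof.
have E j : 'D_(delta_mx 0 j) (fun=> c) = (fun=> 0) :> ('rV[R]_n -> R).
  by apply/funext => x; exact: derive_cst.
elim: k c E => [|k IH] c E; split=> //.
- by move=> x _; exact: cst_continuous.
- by move=> x _; exact: cst_continuous.
- move=> j; split; first by move=> x _; exact: derivable_cst.
  by rewrite E; apply: IH => j'; apply/funext => x; exact: derive_cst.
Qed.

Lemma CkD k U f g : open U -> Ck k U f -> Ck k U g ->
  Ck k U (fun x => f x + g x).
Proof.
elim: k f g => [|k IH] f g oU [cf df] [cg dg]; split=> //.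
- by move=> x Ux; exact: (continuousD (cf x Ux) (cg x Ux)).
- by move=> x Ux; exact: (continuousD (cf x Ux) (cg x Ux)).
- move=> j; have [dfj ckf] := df j; have [dgj ckg] := dg j; split.
    by move=> x Ux; apply: derivableD; [exact: dfj|exact: dgj].
  apply: Ck_eq (IH _ _ oU ckf ckg) => // x Ux.
  by rewrite -(deriveD (dfj x Ux) (dgj x Ux)).
Qed.

Lemma CkM k U f g : open U -> Ck k U f -> Ck k U g ->
  Ck k U (fun x => f x * g x).
Proof.
elim: k f g => [|k IH] f g oU Cf Cg; split=> //.
- by move=> x Ux; exact: (continuousM (Cf.1 x Ux) (Cg.1 x Ux)).
- by move=> x Ux; exact: (continuousM (Cf.1 x Ux) (Cg.1 x Ux)).
- move=> j; have [dfj ckf] := Cf.2 j; have [dgj ckg] := Cg.2 j; split.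
    by move=> x Ux; apply: derivableM; [exact: dfj|exact: dgj].
  apply: (@Ck_eq _ _ (fun x => f x * 'D_(delta_mx 0 j) g x
                             + g x * 'D_(delta_mx 0 j) f x)) => //.
    by move=> x Ux; rewrite (deriveM (dfj x Ux) (dgj x Ux)).
  by apply: CkD => //; apply: IH => //; exact: Ck_le.
Qed.

End Euclidean.

(** * Smooth manifolds *)

(* [cmap i] is a chart on the open set [cdom i], with inverse [cinv i]; the
   values of [cmap i] outside [cdom i] and of [cinv i] outside
   [cmap i @` cdom i] are irrelevant. *)
Record manifold (R : realType) := Manifold {
  mcarrier :> topologicalType;
  mdim : nat;
  m_hausdorff : hausdorff_space mcarrier;
  m_second_countable : @second_countable mcarrier;
  chart : Type;
  cdom : chart -> set mcarrier;
  cmap : chart -> mcarrier -> 'rV[R]_mdim;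
  cinv : chart -> 'rV[R]_mdim -> mcarrier;
  cdom_open : forall i, open (cdom i);
  cimg_open : forall i, open (cmap i @` cdom i);
  cmapK : forall i x, cdom i x -> cinv i (cmap i x) = x;
  cmap_continuous : forall i x, cdom i x -> {for x, continuous (cmap i)};
  cinv_continuous : forall i y, (cmap i @` cdom i) y ->
    {for y, continuous (cinv i)};
  cdom_cover : forall x, exists i, cdom i x;
  ctransition : forall i j (k : 'I_mdim),
    smooth_on (cmap i @` (cdom i `&` cdom j))
              (fun y => cmap j (cinv i y) 0 k)
}.

Section SmoothFunctions.
Context {R : realType} (M : manifold R).
Implicit Types (W : set M) (f g : M -> R).

(* Smoothness on the open set W. *)
Definition smoothM W f :=
  forall i : chart M, smooth_on (cmap i @` (cdom i `&` W)) (f \o cinv i).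

Lemma cimg_openI (i : chart M) W : open W -> open (cmap i @` (cdom i `&` W)).
Proof.
move=> oW; rewrite openE => _ [x [Ux Wx] <-]; rewrite /interior.
have Iy : (cmap i @` cdom i) (cmap i x) by exists x.
have nW : nbhs (cinv i (cmap i x)) W.
  by rewrite (cmapK Ux); exact: open_nbhs_nbhs.
have {}nW : nbhs (cmap i x) (cinv i @^-1` W) := cinv_continuous Iy nW.
have nI := open_nbhs_nbhs (conj (@cimg_open _ M i) Iy).
apply: filterS (filterI nW nI) => y [/= Wy [z Uz zy]].
by exists z => //; split=> //; move: Wy; rewrite -zy (cmapK Uz).
Qed.

Lemma smoothM_cst W (c : R) : smoothM W (fun=> c).
Proof. by move=> i k; exact: Ck_cst. Qed.

Lemma smoothMD W f g : open W -> smoothM W f -> smoothM W g ->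
  smoothM W (fun x => f x + g x).
Proof. by move=> oW sf sg i k; exact: CkD (cimg_openI oW) (sf i k) (sg i k). Qed.

Lemma smoothMM W f g : open W -> smoothM W f -> smoothM W g ->
  smoothM W (fun x => f x * g x).
Proof. by move=> oW sf sg i k; exact: CkM (cimg_openI oW) (sf i k) (sg i k). Qed.

Lemma smoothMN W f : open W -> smoothM W f -> smoothM W (fun x => - f x).
Proof.
move=> oW sf; have := smoothMM oW (smoothM_cst W (-1)) sf.
by congr smoothM; apply/funext => x; rewrite mulN1r.
Qed.

Lemma smoothM_sum W (I : Type) (r : seq I) (F : I -> M -> R) : open W ->
  (forall i, smoothM W (F i)) -> smoothM W (fun x => \sum_(i <- r) F i x).
Proof.
move=> oW sF; elim: r => [|i r IH].
  rewrite (_ : (fun _ => _) = fun=> 0); first exact: smoothM_cst.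
  by apply/funext => x; rewrite big_nil.
rewrite (_ : (fun _ => _) = fun x => F i x + \sum_(j <- r) F j x).
  exact: smoothMD.
by apply/funext => x; rewrite big_cons.
Qed.

Lemma smoothMW W f : smoothM setT f -> open W -> smoothM W f.
Proof.
move=> sf oW i k; have := sf i k; rewrite setIT.
have sub : cmap i @` (cdom i `&` W) `<=` cmap i @` cdom i.
  by move=> _ [x [Ux _] <-]; exists x.
elim: k (f \o _) => [|k IH] g [cg dg]; split=> //; try by move=> x /sub; exact: cg.
by move=> j; have [dj cj] := dg j; split; [move=> x /sub; exact: dj|exact: IH].
Qed.

(* C^oo(M). *)
Record smoothfun := SmoothFun {
  smoothfun_val :> M -> R;
  smoothfunP : smoothM setT smoothfun_val
}.

Lemma smoothfun_eq (f g : smoothfun) : (forall x, f x = g x) -> f = g.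
Proof.
case: f g => [f pf] [g pg] /= /funext fg; move: pf; rewrite fg => pf.
by congr SmoothFun; exact: Prop_irrelevance.
Qed.

HB.instance Definition _ := gen_eqMixin smoothfun.
HB.instance Definition _ := gen_choiceMixin smoothfun.

Definition scst (c : R) : smoothfun := SmoothFun (smoothM_cst setT c).
Definition sadd (f g : smoothfun) : smoothfun :=
  SmoothFun (smoothMD openT (smoothfunP f) (smoothfunP g)).
Definition sopp (f : smoothfun) : smoothfun :=
  SmoothFun (smoothMN openT (smoothfunP f)).
Definition smul (f g : smoothfun) : smoothfun :=
  SmoothFun (smoothMM openT (smoothfunP f) (smoothfunP g)).

Fact saddA : associative sadd.
Proof. by move=> f g h; apply/smoothfun_eq => x /=; rewrite addrA. Qed.
Fact saddC : commutative sadd.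
Proof. by move=> f g; apply/smoothfun_eq => x /=; rewrite addrC. Qed.
Fact sadd0 : left_id (scst 0) sadd.
Proof. by move=> f; apply/smoothfun_eq => x /=; rewrite add0r. Qed.
Fact saddN : left_inverse (scst 0) sopp sadd.
Proof. by move=> f; apply/smoothfun_eq => x /=; rewrite addNr. Qed.
HB.instance Definition _ := 
  GRing.isZmodule.Build smoothfun saddA saddC sadd0 saddN.

Fact smulA : associative smul.
Proof. by move=> f g h; apply/smoothfun_eq => x /=; rewrite mulrA. Qed.
Fact smulC : commutative smul.
Proof. by move=> f g; apply/smoothfun_eq => x /=; rewrite mulrC. Qed.
Fact smul1 : left_id (scst 1) smul.
Proof. by move=> f; apply/smoothfun_eq => x /=; rewrite mul1r. Qed.
Fact smulDl : left_distributive smul +%R.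
Proof. by move=> f g h; apply/smoothfun_eq => x /=; rewrite mulrDl. Qed.
HB.instance Definition _ :=
  GRing.Zmodule_isComPzRing.Build smoothfun smulA smulC smul1 smulDl.

End SmoothFunctions.

(** * Smooth vector bundles, sections *)

(* A bundle of rank [rank] with fibre [fiber x] over x, given by local
   trivialisations with smooth transition functions. *)
Record vbundle (R : realType) (M : manifold R) := VBundle {
  fiber : M -> vectType R;
  rank : nat;
  trivialisation : Type;
  tdom : trivialisation -> set M;
  triv : forall (i : trivialisation) (x : M), 'Hom(fiber x, 'rV[R]_rank);
  tdom_open : forall i, open (tdom i);
  tdom_cover : forall x, exists i, tdom i x;
  triv_bij : forall i x, tdom i x -> bijective (triv i x);
  ttransition : forall i j (a b : 'I_rank),
    smoothM (tdom i `&` tdom j)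
      (fun x => triv j x ((triv i x)^-1%VF (delta_mx 0 a)) 0 b)
}.

Section Sections.
Context {R : realType} {M : manifold R} (A : vbundle M).
Local Notation C := (smoothfun M).

Definition smooth_section (X : forall x, fiber A x) :=
  forall (i : trivialisation A) (b : 'I_(rank A)),
    smoothM (tdom i) (fun x => triv i x (X x) 0 b).

(* Gamma(A). *)
Record sect := Sect {
  sect_val :> forall x, fiber A x;
  sectP : smooth_section sect_val
}.

Lemma sect_eq (X Y : sect) : (forall x, X x = Y x) -> X = Y.
Proof.
case: X Y => [X pX] [Y pY] /= XY.
have {}XY : X = Y by exact: functional_extensionality_dep.
by move: pX; rewrite XY => pX; congr Sect; exact: Prop_irrelevance.
Qed.

HB.instance Definition _ := gen_eqMixin sect.
HB.instance Definition _ := gen_choiceMixin sect.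

Fact sect0_smooth : smooth_section (fun x => 0).
Proof.
move=> i b; rewrite (_ : (fun _ => _) = fun=> 0); first exact: smoothM_cst.
by apply/funext => x; rewrite linear0 mxE.
Qed.
Fact sectD_smooth (X Y : sect) : smooth_section (fun x => X x + Y x).
Proof.
move=> i b; have := smoothMD (tdom_open i) (sectP X i b) (sectP Y i b).
by congr smoothM; apply/funext => x; rewrite linearD mxE.
Qed.
Fact sectN_smooth (X : sect) : smooth_section (fun x => - X x).
Proof.
move=> i b; have := smoothMN (tdom_open i) (sectP X i b).
by congr smoothM; apply/funext => x; rewrite linearN mxE.
Qed.
Fact sectZ_smooth (f : C) (X : sect) : smooth_section (fun x => f x *: X x).
Proof.
move=> i b; have sf := smoothMW (smoothfunP f) (tdom_open i).
have := smoothMM (tdom_open i) sf (sectP X i b).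
by congr smoothM; apply/funext => x; rewrite linearZ mxE.
Qed.

Definition sect0 := Sect sect0_smooth.
Definition sect_add X Y := Sect (sectD_smooth X Y).
Definition sect_opp X := Sect (sectN_smooth X).
Definition sect_scale f X := Sect (sectZ_smooth f X).

Fact sect_addA : associative sect_add.
Proof. by move=> X Y Z; apply: sect_eq => x /=; rewrite addrA. Qed.
Fact sect_addC : commutative sect_add.
Proof. by move=> X Y; apply: sect_eq => x /=; rewrite addrC. Qed.
Fact sect_add0 : left_id sect0 sect_add.
Proof. by move=> X; apply: sect_eq => x /=; rewrite add0r. Qed.
Fact sect_addN : left_inverse sect0 sect_opp sect_add.
Proof. by move=> X; apply: sect_eq => x /=; rewrite addNr. Qed.
HB.instance Definition _ :=
  GRing.isZmodule.Build sect sect_addA sect_addC sect_add0 sect_addN.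

Fact sect_scaleA f g X : sect_scale f (sect_scale g X) = sect_scale (f * g) X.
Proof. by apply: sect_eq => x /=; rewrite scalerA. Qed.
Fact sect_scale1 : left_id 1 sect_scale.
Proof. by move=> X; apply: sect_eq => x /=; rewrite scale1r. Qed.
Fact sect_scaleDr : right_distributive sect_scale +%R.
Proof. by move=> f X Y; apply: sect_eq => x /=; rewrite scalerDr. Qed.
Fact sect_scaleDl X : {morph sect_scale^~ X : f g / f + g}.
Proof. by move=> f g; apply: sect_eq => x /=; rewrite scalerDl. Qed.
HB.instance Definition _ := GRing.Zmodule_isLmodule.Build C sect
  sect_scaleA sect_scale1 sect_scaleDr sect_scaleDl.

End Sections.

(** * Koszul signs of unshuffles *)

(* All boolean masks of length n.  A mask m encodes the unshuffle that moves
   the selected positions, in order, in front of the other ones: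
   X_sigma(1), ..., X_sigma(k) is [mask m s], where k is the number of selected
   positions, and X_sigma(k+1), ..., X_sigma(n) is [mask (map negb m) s]. *)
Fixpoint masks (n : nat) : seq bitseq :=
  if n is n'.+1 then map (cons true) (masks n') ++ map (cons false) (masks n')
  else [:: [::]].

(* Parity of the Koszul sign of the unshuffle m on entries of degrees ds: each
   unselected entry is passed by all the selected entries on its right. *)
Fixpoint koszul (m : bitseq) (ds : seq int) : bool :=
  match m, ds with
  | b :: m', d :: ds' =>
      (~~ b && odd (absz (d * \sum_(e <- mask m' ds') e))) (+) koszul m' ds'
  | _, _ => false
  end.

(** * Exterior algebra of a finite-dimensional vector space *)

Section Exterior.
Context {R : realType} {F : vectType R}.
Implicit Types P Q : seq 'Hom(F, R^o) -> R.

(* The exterior algebra of F, as the algebra of skew-symmetric multilinear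
   functions of covectors: the degree p component of P is its restriction to
   the lists of length p, and the components of degree > dim F vanish. *)
Definition exterior P :=
  (forall s t c a b,
     P (s ++ (c *: a + b) :: t) = c * P (s ++ a :: t) + P (s ++ b :: t)) /\
  (forall s t a, P (s ++ a :: a :: t) = 0).

(* Normalised so that (v_1 ^ ... ^ v_p)(xi_1, ..., xi_p) = det (xi_i v_j). *)
Definition ewedge P Q : seq 'Hom(F, R^o) -> R := fun s =>
  \sum_(m <- masks (size s))
    (-1) ^+ koszul m (nseq (size s) 1) *
      (P (mask m s) * Q (mask (map negb m) s)).

Lemma koszul_nseq m n : size m = n ->
  \sum_(e <- mask m (nseq n (1 : int))) e = (count id m)%:Z.
Proof.
move=> <-; elim: m => [|b m IH] /=; first by rewrite big_nil.
by case: b => /=; rewrite ?big_cons IH ?add0n // PoszD.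
Qed.

Lemma size_masks n m : m \in masks n -> size m = n.
Proof.
elim: n m => [|n IH] m /=; first by rewrite inE => /eqP ->.
by rewrite mem_cat => /orP[] /mapP[m' /IH <- ->].
Qed.

Lemma ewedge_cons P Q a s :
  ewedge P Q (a :: s) =
  ewedge (fun u => P (a :: u)) Q s +
  ewedge (fun u => (-1) ^+ size u * P u) (fun u => Q (a :: u)) s.
Proof.
rewrite /ewedge /= big_cat !big_map /=; congr (_ + _).
apply: eq_big_seq => m /size_masks sm.
rewrite koszul_nseq // mul1r absz_nat size_mask // signr_addb signr_odd.
by rewrite -!mulrA [LHS]mulrCA.
Qed.

Lemma exterior_cons P a : exterior P -> exterior (fun u => P (a :: u)).
Proof.
by case=> lP aP; split=> [s t c x y|s t x]; [exact: (lP (a :: s))|exact: (aP (a :: s))].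
Qed.

Lemma exterior_sign P : exterior P -> exterior (fun u => (-1) ^+ size u * P u).
Proof.
case=> lP aP; split=> [s t c x y|s t x]; last by rewrite aP mulr0.
by rewrite lP !size_cat /= mulrDr mulrCA.
Qed.

Lemma ewedge_exterior P Q : exterior P -> exterior Q -> exterior (ewedge P Q).
Proof.
move=> eP eQ; split.
- move=> s; elim: s P Q eP eQ => [|x s IH] P Q eP eQ t c a b.
    rewrite /= !ewedge_cons /ewedge mulrDr !mulr_sumr -!big_split /=.
    apply: eq_bigr => m _; have [lP _] := eP; have [lQ _] := eQ.
    rewrite (lP [::]) (lQ [::]) /=.
    ring.
  rewrite !cat_cons !ewedge_cons.
  rewrite !IH; try exact: exterior_cons; try exact: exterior_sign; try by [].
  by rewrite mulrDr addrACA.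
- move=> s; elim: s P Q eP eQ => [|x s IH] P Q eP eQ t a; last first.
    rewrite cat_cons ewedge_cons !IH ?addr0 //;
      by [exact: exterior_cons|exact: exterior_sign].
  rewrite /= !ewedge_cons.
  have [_ aP] := eP; have [_ aQ] := eQ.
  rewrite /ewedge -!big_split big1 //= => m _.
  rewrite (aP [::]) (aQ [::]) !(mulr0, mul0r) add0r addr0 exprS -mulrDr.
  by rewrite -mulrDl !mulN1r mulNr addrN mul0r mulr0.
Qed.

End Exterior.

(** * Multivector fields: smooth sections of the exterior algebra bundle *)

Section Multivectors.
Context {R : realType} {M : manifold R} (A : vbundle M).
Local Notation C := (smoothfun M).

(* The a-th element of the dual frame of a local trivialisation. *)
Definition coframe (i : trivialisation A) (x : M) (a : 'I_(rank A)) :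
    'Hom(fiber A x, R^o) :=
  linfun (fun v => triv i x v 0 a : R^o).

Lemma coframeE i x a v : coframe i x a v = triv i x v 0 a.
Proof.
have lin : linear (fun v => triv i x v 0 a : R^o).
  by move=> c u w; rewrite linearP !mxE.
pose L := GRing.isLinear.Build R _ R^o _ _ lin.
pose f : {linear fiber A x -> R^o} := HB.pack (fun v => triv i x v 0 a : R^o) L.
exact: (lfunE f v).
Qed.

Definition smooth_multivector (P : forall x, seq 'Hom(fiber A x, R^o) -> R) :=
  forall (i : trivialisation A) (J : seq 'I_(rank A)),
    smoothM (tdom i) (fun x => P x [seq coframe i x a | a <- J]).

(* Gamma(wedge A), all degrees together. *)
Record mvect := MVect {
  mv :> forall x, seq 'Hom(fiber A x, R^o) -> R;
  mv_exterior : forall x, exterior (@mv x);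
  mv_smooth : smooth_multivector (@mv)
}.

Lemma mv_eq (P Q : mvect) : (forall x s, P x s = Q x s) -> P = Q.
Proof.
case: P Q => [P eP sP] [Q eQ sQ] /= PQ.
have {}PQ : P = Q.
  by apply: functional_extensionality_dep => x; apply/funext => s.
move: eP sP; rewrite PQ => eP sP.
by congr MVect; exact: Prop_irrelevance.
Qed.

HB.instance Definition _ := gen_eqMixin mvect.
HB.instance Definition _ := gen_choiceMixin mvect.

Fact mv0_exterior x : exterior (fun _ : seq 'Hom(fiber A x, R^o) => 0 : R).
Proof. by split=> [s t c a b|s t a] //; rewrite mulr0 addr0. Qed.
Fact mv0_smooth : smooth_multivector (fun x _ => 0).
Proof. by move=> i J; exact: smoothM_cst. Qed.
Definition mv0 := MVect mv0_exterior mv0_smooth.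

Fact mvD_exterior (P Q : mvect) x : exterior (fun s => P x s + Q x s).
Proof.
have [lP aP] := mv_exterior P x; have [lQ aQ] := mv_exterior Q x.
split=> [s t c a b|s t a]; last by rewrite aP aQ addr0.
by rewrite lP lQ mulrDr addrACA.
Qed.
Fact mvD_smooth (P Q : mvect) : smooth_multivector (fun x s => P x s + Q x s).
Proof.
by move=> i J; exact: smoothMD (tdom_open i) (mv_smooth P i J) (mv_smooth Q i J).
Qed.
Definition mv_add P Q := MVect (mvD_exterior P Q) (mvD_smooth P Q).

Fact mvZ_exterior (c : R) (P : mvect) x : exterior (fun s => c * P x s).
Proof.
have [lP aP] := mv_exterior P x.
split=> [s t d a b|s t a]; last by rewrite aP mulr0.
by rewrite lP mulrDr mulrCA.
Qed.
Fact mvZ_smooth (c : R) (P : mvect) : smooth_multivector (fun x s => c * P x s).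
Proof.
by move=> i J; exact: smoothMM (tdom_open i) (smoothM_cst _ c) (mv_smooth P i J).
Qed.
Definition mv_scale c P := MVect (mvZ_exterior c P) (mvZ_smooth c P).

Fact mv_addA : associative mv_add.
Proof. by move=> P Q S; apply: mv_eq => x s /=; rewrite addrA. Qed.
Fact mv_addC : commutative mv_add.
Proof. by move=> P Q; apply: mv_eq => x s /=; rewrite addrC. Qed.
Fact mv_add0 : left_id mv0 mv_add.
Proof. by move=> P; apply: mv_eq => x s /=; rewrite add0r. Qed.
Fact mv_addN : left_inverse mv0 (mv_scale (-1)) mv_add.
Proof. by move=> P; apply: mv_eq => x s /=; rewrite mulN1r addNr. Qed.
HB.instance Definition _ :=
  GRing.isZmodule.Build mvect mv_addA mv_addC mv_add0 mv_addN.

Fact mv_scaleA c d P : mv_scale c (mv_scale d P) = mv_scale (c * d) P.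
Proof. by apply: mv_eq => x s /=; rewrite mulrA. Qed.
Fact mv_scale1 : left_id 1 mv_scale.
Proof. by move=> P; apply: mv_eq => x s /=; rewrite mul1r. Qed.
Fact mv_scaleDr : right_distributive mv_scale +%R.
Proof. by move=> c P Q; apply: mv_eq => x s /=; rewrite mulrDr. Qed.
Fact mv_scaleDl P : {morph mv_scale^~ P : c d / c + d}.
Proof. by move=> c d; apply: mv_eq => x s /=; rewrite mulrDl. Qed.
HB.instance Definition _ := GRing.Zmodule_isLmodule.Build R mvect
  mv_scaleA mv_scale1 mv_scaleDr mv_scaleDl.

Fact wedge_exterior (P Q : mvect) x : exterior (ewedge (P x) (Q x)).
Proof. by apply: ewedge_exterior; exact: mv_exterior. Qed.
Fact wedge_smooth (P Q : mvect) :
  smooth_multivector (fun x => ewedge (P x) (Q x)).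
Proof.
move=> i J; rewrite /ewedge.
rewrite (_ : (fun _ => _) = fun x => \sum_(m <- masks (size J))
    (-1) ^+ koszul m (nseq (size J) 1) *
    (P x [seq coframe i x a | a <- mask m J] *
     Q x [seq coframe i x a | a <- mask (map negb m) J])); last first.
  by apply/funext => x; rewrite size_map; apply: eq_bigr => m _; rewrite !map_mask.
apply: (smoothM_sum _ (tdom_open i)) => m.
apply: smoothMM (tdom_open i) (smoothM_cst _ _) _.
exact: smoothMM (tdom_open i) (mv_smooth P i _) (mv_smooth Q i _).
Qed.
Definition mvwedge P Q := MVect (wedge_exterior P Q) (wedge_smooth P Q).

(* Functions, as multivector fields of degree 0. *)
Definition mvfun_val (f : C) x (s : seq 'Hom(fiber A x, R^o)) : R :=
  if s is [::] then f x else 0.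
Fact mvfun_exterior f x : exterior (@mvfun_val f x).
Proof.
by split=> [[|? ?] t c a b|[|? ?] t a] //=; rewrite mulr0 addr0.
Qed.
Fact mvfun_smooth f : smooth_multivector (mvfun_val f).
Proof.
move=> i [|a J] /=; last exact: smoothM_cst.
exact: smoothMW (smoothfunP f) (tdom_open i).
Qed.
Definition mvfun f := MVect (mvfun_exterior f) (mvfun_smooth f).

(* Sections of A, as multivector fields of degree 1. *)
Definition mvsect_val (X : sect A) x (s : seq 'Hom(fiber A x, R^o)) : R :=
  if s is [:: xi] then xi (X x) else 0.
Fact mvsect_exterior X x : exterior (@mvsect_val X x).
Proof.
split=> [s t c a b|s t a]; last by case: s => [|? [|? ?]].
case: s t => [|? [|? ?]] [|? ?] /=; rewrite ?mulr0 ?addr0 //.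
by rewrite add_lfunE scale_lfunE.
Qed.
Fact mvsect_smooth X : smooth_multivector (mvsect_val X).
Proof.
move=> i [|a [|b J]] /=; try exact: smoothM_cst.
rewrite (_ : (fun _ => _) = fun x => triv i x (X x) 0 a).
  exact: sectP.
by apply/funext => x; rewrite coframeE.
Qed.
Definition mvsect X := MVect (mvsect_exterior X) (mvsect_smooth X).

(* X_1 ^ ... ^ X_p *)
Definition wedges (s : seq (sect A)) : mvect :=
  foldr (fun X P => mvwedge (mvsect X) P) (mvfun 1) s.

(* Homogeneous elements and components of Gamma(wedge A)[2]: the elements of
   Gamma(wedge^p A) have degree p - 2. *)
Definition has_degree (z : int) (P : mvect) :=
  forall x s, (size s)%:Z - 2 != z -> P x s = 0.

Definition multivector (p : nat) (P : mvect) := has_degree (p%:Z - 2) P.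

Definition component_val (z : int) (P : mvect) x
    (s : seq 'Hom(fiber A x, R^o)) : R :=
  if (size s)%:Z - 2 == z then P x s else 0.
Fact component_exterior z P x : exterior (@component_val z P x).
Proof.
have [lP aP] := mv_exterior P x.
split=> [s t c a b|s t a]; rewrite /component_val !size_cat /=.
  by case: ifP => _; rewrite ?mulr0 ?addr0 ?lP.
by rewrite aP if_same.
Qed.
Fact component_smooth z P : smooth_multivector (component_val z P).
Proof.
move=> i J; rewrite (_ : (fun _ => _) = fun x =>
    if (size J)%:Z - 2 == z then P x [seq coframe i x a | a <- J] else 0).
  by case: (_ == z); [exact: mv_smooth|exact: smoothM_cst].
by apply/funext => x; rewrite /component_val size_map.
Qed.
Definition component z P :=
  MVect (component_exterior z P) (component_smooth z P).

End Multivectors.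

(** * Lie algebroids *)

Section LieAlgebroid.
Context {R : realType} {M : manifold R} (A : vbundle M).
Local Notation C := (smoothfun M).

(* Tangent vectors of M at x. *)
Record point_derivation (x : M) (D : C -> R) : Prop := PointDerivation {
  pderD : forall f g, D (f + g) = D f + D g;
  pderZ : forall (c : R) f, D (scst M c * f) = c * D f;
  pderM : forall f g, D (f * g) = D f * g x + f x * D g
}.

(* [anchor] is a smooth vector bundle morphism A -> TM. *)
Record lie_algebroid := LieAlgebroid {
  anchor : forall x : M, fiber A x -> C -> R;
  anchor_tangent : forall x v, point_derivation x (@anchor x v);
  anchor_linear : forall x f, linear (fun v => @anchor x v f : R^o);
  anchor_smooth : forall (X : sect A) (f : C),
    smoothM setT (fun x => @anchor x (X x) f);
  lbracket : sect A -> sect A -> sect A;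
  lbracketDl : forall X Y Z, lbracket (X + Y) Z = lbracket X Z + lbracket Y Z;
  lbracketZl : forall (c : R) X Y,
    lbracket (scst M c *: X) Y = scst M c *: lbracket X Y;
  lbracketC : forall X Y, lbracket X Y = - lbracket Y X;
  lbracket_jacobi : forall X Y Z,
    lbracket X (lbracket Y Z) =
    lbracket (lbracket X Y) Z + lbracket Y (lbracket X Z);
  lbracket_leibniz : forall X (f : C) Y,
    lbracket X (f *: Y) =
    SmoothFun (anchor_smooth X f) *: Y + f *: lbracket X Y
}.

Context (L : lie_algebroid).
Local Notation V := (mvect A).

(* The derivation rho(X) of C^oo(M). *)
Definition rho (X : sect A) (f : C) : C := SmoothFun (anchor_smooth L X f).

Definition omit (T : Type) (i : nat) (s : seq T) := take i s ++ drop i.+1 s.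

(* The Chevalley-Eilenberg differential; a k-form on A is regarded as a
   function of lists of sections: only its values on lists of length k matter. *)
Definition dA (w : seq (sect A) -> C) (s : seq (sect A)) : C :=
  \sum_(i < size s) (-1) ^+ i * rho s`_i (w (omit i s)) +
  \sum_(i < size s) \sum_(j < size s | (i < j)%N)
    (-1) ^+ (i + j) * w (lbracket L s`_i s`_j :: omit i (omit j s)).

Record two_form (a : sect A -> sect A -> C) : Prop := TwoForm {
  two_form_linear : forall Y f X X', a (f *: X + X') Y = f * a X Y + a X' Y;
  two_form_skew : forall X Y, a X Y = - a Y X
}.

Definition dA_closed (a : sect A -> sect A -> C) :=
  forall X Y Z, dA (fun s => a s`_0 s`_1) [:: X; Y; Z] = 0.

Definition form_twist (N : sect A -> sect A) (a : sect A -> sect A -> C) :=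
  fun X Y => a (N X) Y.

Record omegaN (N : sect A -> sect A) (a : sect A -> sect A -> C) : Prop :=
  OmegaN {
    omegaN_tensor : linear N;
    omegaN_form : two_form a;
    omegaN_skew : forall X Y, form_twist N a X Y = - form_twist N a Y X;
    omegaN_closed : dA_closed a;
    omegaN_twist_closed : dA_closed (form_twist N a)
  }.

Definition torsion (N : sect A -> sect A) (X Y : sect A) : sect A :=
  lbracket L (N X) (N Y)
  - N (lbracket L (N X) Y + lbracket L X (N Y) - N (lbracket L X Y)).

(** ** Schouten-Nijenhuis bracket and extensions to multivector fields *)

Record is_schouten (B : V -> V -> V) : Prop := IsSchouten {
  schouten_linear : forall P, linear (B P);
  schouten_linearl : forall Q, linear (B^~ Q);
  schouten_sect_fun : forall X f, B (mvsect X) (mvfun A f) = mvfun A (rho X f);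
  schouten_sect : forall X Y, B (mvsect X) (mvsect Y) = mvsect (lbracket L X Y);
  schouten_fun : forall f g, B (mvfun A f) (mvfun A g) = 0;
  schouten_skew : forall (p q : nat) P Q, multivector p P -> multivector q Q ->
    B P Q = - (-1 : R) ^ ((p%:Z - 1) * (q%:Z - 1)) *: B Q P;
  schouten_leibniz : forall (p q : nat) P Q S,
    multivector p P -> multivector q Q ->
    B P (mvwedge Q S) =
    mvwedge (B P Q) S + (-1 : R) ^ ((p%:Z - 1) * q%:Z) *: mvwedge Q (B P S)
}.

(* l_2(P, Q) = (-1)^(p-1) [P, Q] for P of degree p, extended linearly. *)
Definition l2 (B : V -> V -> V) (P Q : V) : V :=
  \sum_(p < (rank A).+1)
    (-1 : R) ^ (p%:Z - 1) *: B (component (p%:Z - 2) P) Q.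

(* NN is the extension of N by derivation.  Multivector fields are sums of
   products of sections, so that NN is determined by its R-linearity and its
   values on products; C^oo(M)-linearity is a consequence, recorded because
   the extension is a tensor. *)
Record is_der_ext (N : sect A -> sect A) (NN : V -> V) : Prop := IsDerExt {
  der_ext_linear : linear NN;
  der_ext_tensor : forall f P,
    NN (mvwedge (mvfun A f) P) = mvwedge (mvfun A f) (NN P);
  der_ext_fun : forall f, NN (mvfun A f) = 0;
  der_ext_wedges : forall s : seq (sect A),
    NN (wedges s) = \sum_(i < size s) wedges (set_nth 0 s i (N s`_i))
}.

(* AA is the extension of the 2-form a.  The sign (-1)^(p+i+j+1), in terms of
   the degree p of the first argument, is the one for which AA is a
   biderivation of degree 0:
     AA(P, Q ^ S) = AA(P, Q) ^ S + (-1)^(p q) Q ^ AA(P, S).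
   With q in place of p, AA would be multiplied by (-1)^(p+q), and
   [AA, l_2]_RN would not vanish for closed forms a.  C^oo(M)-bilinearity is
   recorded for the same reason as in [is_der_ext]. *)
Record is_form_ext (a : sect A -> sect A -> C) (AA : V -> V -> V) : Prop :=
  IsFormExt {
    form_ext_linear : forall P, linear (AA P);
    form_ext_linearl : forall Q, linear (AA^~ Q);
    form_ext_tensor : forall f P Q,
      AA P (mvwedge (mvfun A f) Q) = mvwedge (mvfun A f) (AA P Q);
    form_ext_tensorl : forall f P Q,
      AA (mvwedge (mvfun A f) P) Q = mvwedge (mvfun A f) (AA P Q);
    form_ext_fun : forall f P, AA P (mvfun A f) = 0;
    form_ext_funl : forall f P, AA (mvfun A f) P = 0;
    form_ext_wedges : forall s t : seq (sect A),
      AA (wedges s) (wedges t) =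
      \sum_(i < size s) \sum_(j < size t)
        (-1 : R) ^+ (size s + i + j + 1) *:
          mvwedge (mvfun A (a s`_i t`_j))
            (mvwedge (wedges (omit i s)) (wedges (omit j t)))
  }.

End LieAlgebroid.

(** * Vector valued forms on Gamma(wedge A)[2], Richardson-Nijenhuis bracket *)

Section RichardsonNijenhuis.
Context {R : realType} {M : manifold R} (A : vbundle M).
Local Notation V := (mvect A).

(* A sum of vector valued k-forms over all k: its k-form component is its
   restriction to the lists of length k. *)
Definition vform := seq V -> V.

Definition vform1 (f : V -> V) : vform := fun s =>
  if s is [:: P] then f P else 0.
Definition vform2 (f : V -> V -> V) : vform := fun s =>
  if s is [:: P; Q] then f P Q else 0.
Definition vform_add (K L : vform) : vform := fun s => K s + L s.

(* The components of K are graded symmetric multilinear maps of degree e. *)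
Record graded_vform (e : int) (K : vform) : Prop := GradedVForm {
  vform_linear : forall s t (c : R) P Q,
    K (s ++ (c *: P + Q) :: t) = c *: K (s ++ P :: t) + K (s ++ Q :: t);
  vform_sym : forall s t (x y : int) P Q, has_degree x P -> has_degree y Q ->
    K (s ++ P :: Q :: t) = (-1 : R) ^ (x * y) *: K (s ++ Q :: P :: t);
  vform_degree : forall (ds : seq int) (s : seq V), size ds = size s ->
    (forall i, (i < size s)%N -> has_degree ds`_i s`_i) ->
    has_degree (\sum_(d <- ds) d + e) (K s)
}.

(* iota_K L: the sum over ds decomposes the arguments into their homogeneous
   components (of degrees d - 2 with d <= rank A), on which the Koszul sign is
   defined; the sum over m is the sum over the unshuffles of all types
   (k, l - 1). *)
Definition insertion (K L : vform) : vform := fun s =>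
  \sum_(ds : (size s).-tuple 'I_(rank A).+1)
  \sum_(m <- masks (size s))
    let degs := [seq (val d)%:Z - 2 | d : 'I_(rank A).+1 <- ds] in
    let s' := [seq component zP.1 zP.2 | zP <- zip degs s] in
    (-1 : R) ^+ koszul m degs *: L (K (mask m s') :: mask (map negb m) s').

(* [K, L]_RN for K of degree k and L of degree l. *)
Definition RN (k l : int) (K L : vform) : vform := fun s =>
  insertion K L s - (-1 : R) ^ (k * l) *: insertion L K s.

(* N is Nijenhuis with respect to mu, with square K. *)
Record nijenhuis (mu N K : vform) : Prop := Nijenhuis {
  nijenhuis_mu : graded_vform 1 mu;
  nijenhuis_form : graded_vform 0 N;
  nijenhuis_square : graded_vform 0 K;
  nijenhuis_deformed : RN 0 1 N (RN 0 1 N mu) =1 RN 0 1 K mu;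
  nijenhuis_commute : forall s, RN 0 0 N K s = 0
}.

End RichardsonNijenhuis.

(* Main.v *)
(* A derivation of the exterior algebra Gamma(wedge A) that vanishes on functions
   and sections is zero: it is then tensorial, and near any point a multivector
   field is a combination of products of sections.  With respect to each
   argument, the extension of N, the extension of a 2-form and l_2 are graded
   derivations, hence so are the values of their Richardson-Nijenhuis brackets,
   being sums of graded commutators of derivations; every identity needed can
   therefore be tested on functions and sections.  There, [a, l_2] is d^A a = 0,
   [a_N, l_2] is d^A a_N = 0, [a, [N, l_2]] is
   d_N a = i_N d^A a - 2 d^A a_N = 0, and [N, [N, l_2]] - [N^2, l_2] is twice
   the torsion of N. *)
From mathcomp Require Import all_boot all_order all_algebra.
From mathcomp Require Import all_classical all_reals all_analysis.
From mathcomp Require Import ring lra zify.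
Require Import Defs.

Set Implicit Arguments.
Unset Strict Implicit.
Unset Printing Implicit Defensive.

Import Order.TTheory GRing.Theory Num.Theory.
Import numFieldNormedType.Exports.

Local Open Scope classical_set_scope.
Local Open Scope ring_scope.

(** * Bump functions *)

(** The obstacle is that the extensions are specified only on products of sections, while an
    abstract bundle has only local frames. Tensoriality replaces locality: a bump function psi
    multiplies both a local frame and the contractions with its dual frame, so that both become
    global, and the Euler identity writes p psi^2 P as a sum of products of a section with a field
    of degree p - 1. Evaluating where psi does not vanish gives D P = 0 by induction on p, without
    partitions of unity. Signs depend on degrees, while tensorial arguments need all fields at once.
    Degrees are therefore read off the scaling automorphisms [theta c]: c = -1 gives the parities,
    on which alone the Koszul signs depend, and c = 2 detects the exact degree. A bracket of two
    binary forms is visibly a derivation in its last argument only; graded symmetry brings the other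
    arguments there. Sorted by arity, the only terms that do not vanish separately are [N, [N, l_2]]
    against [N^2, l_2], and [N, a_N] against [N^2, a]. *)

Section FlatFunctions.
Context {R : realType}.
Implicit Types (g : R -> R) (t : R) (n k : nat).

Fixpoint smooth1 k g : Prop :=
  if k is k'.+1 then
    exists2 g' : R -> R, (forall t, is_derive t 1 g (g' t)) & smooth1 k' g'
  else continuous g.

Lemma smooth1_lin k g1 g2 (c : R) : smooth1 k g1 -> smooth1 k g2 ->
  smooth1 k (fun t => c * g1 t + g2 t).
Proof.
elim: k g1 g2 => [|k IH] g1 g2.
  move=> c1 c2 t; apply: cvgD; last exact: c2.
  by apply: cvgM; [exact: cvg_cst|exact: c1].
move=> [d1 h1 s1] [d2 h2 s2]; exists (fun t => c * d1 t + d2 t); last exact: IH.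
move=> t; have := h1 t; have := h2 t => ? ?.
exact: (@is_deriveD _ _ _ (c \*: g1) g2).
Qed.

(** For n = 0 this is the classical flat function. The powers t^-n make the family stable under
    derivation up to linear combinations, so that one induction gives all orders of smoothness. *)
Definition flat n t : R := if 0 < t then t ^- n * expR (- t^-1) else 0.

Lemma flat_gt0 n t : 0 < t -> 0 < flat n t.
Proof. by move=> t0; rewrite /flat t0 mulr_gt0 ?expR_gt0 ?invr_gt0 ?exprn_gt0. Qed.

Lemma flat_le0 n t : t <= 0 -> flat n t = 0.
Proof. by rewrite /flat leNgt => /negbTE ->. Qed.

(** The exponential series at 1/t dominates its term of order n. *)
Lemma flat_bound n t : 0 < t -> t ^- n * expR (- t^-1) <= n`!%:R.
Proof.
case: n => [|n] t0.
  by rewrite expr0 invr1 mul1r fact0 expR_le1 oppr_le0 invr_ge0 ltW.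
rewrite expRN ler_pdivrMr ?expR_gt0 // -exprVn.
have := @expR_ge1Dxn R t^-1 n; rewrite invr_ge0 (ltW t0) => /(_ isT) h.
have f0 : 0 < n.+1`!%:R :> R by rewrite ltr0n fact_gt0.
rewrite mulrC -ler_pdivrMr //; apply: le_trans h.
by rewrite lerDr ler01.
Qed.

Lemma flat_derive n t :
  is_derive t 1 (flat n) ((- n%:R) * flat n.+1 t + flat n.+2 t).
Proof.
have [t0|t0|->] := ltgtP t 0.
- rewrite !flat_le0 ?ltW // mulr0 addr0.
  apply: (@near_eq_is_derive _ _ _ (cst 0)).
  near=> s; rewrite /= flat_le0 // ltW //; near: s.
  exact: (open_nbhs_nbhs (conj (@open_lt R 0) t0)).
- pose F : R -> R := (fun s => (s^-1) ^+ n) * (expR \o (fun s => - s^-1)).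
  apply: (@near_eq_is_derive _ _ _ F).
    near=> s; rewrite /F /flat ifT; first by rewrite -exprVn.
    near: s; exact: (open_nbhs_nbhs (conj (@open_gt R 0) t0)).
  have tn0 : t != 0 by rewrite gt_eqF.
  have i1 := @is_deriveV R id t 1 1 tn0 (is_derive_id t 1).
  have i2 : is_derive t 1 (fun s : R => (s^-1) ^+ n)
      ((n%:R * t^-1 ^+ n.-1) *: (- t ^- 2 *: 1)).
    by rewrite -[fun _ => _]exprfctE; exact: (@is_deriveX _ _ (fun s : R => s^-1) n t 1 _ i1).
  have i3 : is_derive t 1 (expR \o (fun s : R => - s^-1))
      (expR (- t^-1) * - (- t ^- 2 *: 1)).
    apply: is_derive1_comp; exact: (@is_deriveN _ _ _ (fun s : R => s^-1) t 1 _ i1).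
  have i4 := @is_deriveM _ _ _ _ _ _ _ _ i2 i3; apply: (is_derive_eq i4).
  rewrite /flat t0 /= /GRing.scale /= !mulr1 -!exprVn.
  case: n {F i2 i4} => [|n] /=; rewrite ?expr0 ?mulr0 ?mul0r ?oppr0 ?addr0 ?add0r.
    ring.
  rewrite !exprS; ring.
- rewrite !flat_le0 // mulr0 addr0.
  have C : (fun h : R => h^-1 *: ((flat n \o shift 0) (h *: 1) - flat n 0)) @ 0^' --> (0 : R).
    apply/cvgr0Pnorm_le => e e0.
    near=> h.
    rewrite /= addr0 [h *: 1]mulr1 [flat n 0]flat_le0 // subr0.
    have [h0|h0] := leP h 0; first by rewrite flat_le0 // scaler0 normr0 ltW.
    rewrite ger0_norm; last by rewrite mulr_ge0 ?invr_ge0 ?ltW ?flat_gt0.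
    rewrite /flat h0 /GRing.scale /= mulrA -invfM -exprS.
    (* Borrowing one more power of h leaves a factor bounded by (n+2)!, so the difference quotient
       is O(h). *)
    have -> : h ^- n.+1 * expR (- h^-1) = h * (h ^- n.+2 * expR (- h^-1)).
      by rewrite mulrA -!exprVn [_ ^+ n.+2]exprS mulrA divff ?gt_eqF // mul1r.
    apply: le_trans (ler_wpM2l (ltW h0) (flat_bound _ h0)) _.
    rewrite -ler_pdivlMr ?ltr0n ?fact_gt0 //.
    apply: le_trans (ler_norm _) _.
    near: h; apply: dnbhs0_le; by rewrite divr_gt0 ?ltr0n ?fact_gt0.
  by split; [apply/cvg_ex; exists 0|exact/cvg_lim].
Unshelve. all: by end_near. Qed.

Lemma flat_smooth k n : smooth1 k (flat n).
Proof.
elim: k n => [|k IH] n.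
  move=> t; apply/differentiable_continuous/derivable1_diffP.
  by case: (flat_derive n t).
exists (fun t => (- n%:R) * flat n.+1 t + flat n.+2 t); first exact: flat_derive.
by apply: smooth1_lin.
Qed.

End FlatFunctions.

(** * Chain rule and locality for functions on open subsets of R^n *)

Section LocalSmoothness.
Context {R : realType} {n : nat}.
Implicit Types (U V : set 'rV[R]_n) (f g h : 'rV[R]_n -> R).

(** A directional derivative is a derivative at 0 along a line; this brings the one-variable chain
    rule to functions on R^n. *)
Lemma is_derive_line f (x v : 'rV[R]_n) (d : R) :
  is_derive (0 : R) 1 (fun t : R => f (t *: v + x)) d -> is_derive x v f d.
Proof.
case=> df <-; split; first exact: (derivable1P f x v).2 df.
rewrite /derive; set F := (fun h : R => h^-1 *: _); set G := (fun h : R => h^-1 *: _).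
suff -> : F = G by [].
by apply/funext => t; rewrite /F /G /= addr0 [t%:A]mulr1 scale0r add0r.
Qed.

Lemma derivable_line f (x v : 'rV[R]_n) : derivable f x v ->
  is_derive (0 : R) 1 (fun t : R => f (t *: v + x)) ('D_v f x).
Proof.
move=> df; split; first exact: (derivable1P f x v).1 df.
rewrite /derive; set F := (fun h : R => h^-1 *: _); set G := (fun h : R => h^-1 *: _).
suff -> : F = G by [].
by apply/funext => t; rewrite /F /G /= addr0 [t%:A]mulr1 scale0r add0r.
Qed.

Lemma Ck_comp k U (g : R -> R) h : open U -> smooth1 k g -> Ck k U h ->
  Ck k U (g \o h).
Proof.
elim: k g h => [|k IH] g h oU sg Ch.
  split=> // x Ux; apply: continuous_comp; [exact: Ch.1|exact: sg].
have [g' dg sg'] := sg.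
have dcomp x j : U x ->
    is_derive x (delta_mx 0 j) (g \o h) (g' (h x) * 'D_(delta_mx 0 j) h x).
  move=> Ux; apply: is_derive_line.
  apply: (@is_derive1_comp _ g (fun t => h (t *: _ + x))).
    by rewrite scale0r add0r; exact: dg.
  by apply: derivable_line; have [dh _] := Ch.2 j; exact: dh.
split=> [x Ux|j].
  apply: continuous_comp; first exact: Ch.1.
  apply/differentiable_continuous/derivable1_diffP.
  by case: (dg (h x)).
split=> [x Ux|]; first by case: (dcomp x j Ux).
apply: (@Ck_eq _ _ _ _ (fun x => (g' \o h) x * 'D_(delta_mx 0 j) h x)) => //.
  by move=> x Ux; case: (dcomp x j Ux).
by apply: CkM => //; [apply: IH => //; exact: Ck_le|case: (Ch.2 j)].
Qed.

Lemma Ck_local k U f : (forall x, U x -> exists2 V, V x & Ck k V f) -> Ck k U f.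
Proof.
elim: k f => [|k IH] f Hl; split=> //.
- by move=> x /Hl[V Vx [cf _]]; exact: cf.
- by move=> x /Hl[V Vx [cf _]]; exact: cf.
- move=> j; split; first by move=> x /Hl[V Vx [_ /(_ j)[df _]]]; exact: df.
  by apply: IH => x /Hl[V Vx [_ /(_ j)[_ Cf]]]; exists V.
Qed.

End LocalSmoothness.

Section BumpFunctions.
Context {R : realType} (M : manifold R).
Implicit Types (W U : set M) (f g : M -> R).

Lemma smoothM_eq W f g : open W -> (forall x, W x -> f x = g x) ->
  smoothM W f -> smoothM W g.
Proof.
move=> oW fg sf i k; apply: Ck_eq (sf i k); first exact: cimg_openI.
by move=> _ [x [Ux Wx] <-] /=; rewrite (cmapK Ux) fg.
Qed.

Lemma smoothM_local W f :
  (forall x, W x -> exists2 V, V x & smoothM V f) -> smoothM W f.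
Proof.
move=> Hl i k; apply: Ck_local => _ [x [Ux Wx] <-].
have [V Vx sV] := Hl x Wx; exists (cmap i @` (cdom i `&` V)); last exact: sV.
by exists x.
Qed.

Lemma smoothM_sub U W f : U `<=` W -> smoothM W f -> smoothM U f.
Proof. by move=> UW sf; apply: smoothM_local => x /UW Wx; exists W. Qed.

(** The covering of M by O and U is what later allows anything smooth on U, once multiplied by psi,
    to be extended by zero. In a chart around x, psi is the flat function of r^2 minus the squared
    Euclidean distance. *)
Lemma bump_function U (x : M) : open U -> U x ->
  exists psi : smoothfun M, psi x != 0 /\
    exists2 O : set M, open O &
      (forall y, O y -> psi y = 0) /\ (forall y, O y \/ U y).
Proof.
move=> oU Ux; have [j jx] := @cdom_cover _ M x.
set y0 := cmap j x.
have nW : nbhs y0 (cmap j @` (cdom j `&` U)).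
  by apply: open_nbhs_nbhs; split; [exact: cimg_openI|exists x].
have [r rW] := (nbhs_closedballP _ _).1 nW.
have r0 : 0 < r%:num by [].
set K := closed_ball y0 r%:num in rW.
have cK : compact K.
  apply: bounded_closed_compact; last exact: closed_ball_closed.
  rewrite /K closed_ballE //; exists (`|y0| + r%:num); split => //.
  move=> e lte y /=; rewrite /closed_ball_ /= => yr.
  apply: le_trans (ltW lte).
  rewrite -[y](subrK y0) addrC; apply: le_trans (ler_normD _ _) _.
  by rewrite lerD2l distrC.
have cinvK : compact (cinv j @` K).
  apply: continuous_compact cK; apply: continuous_in_subspaceT => y.
  rewrite inE => /rW[z [jz Uz] <-]; apply: (@cinv_continuous _ M).
  by exists z.
pose H (z : M) := r%:num ^+ 2 - \sum_(k < mdim M) (cmap j z 0 k - y0 0 k) ^+ 2.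
pose psi (z : M) := if `[< cdom j z >] then flat 0 (H z) else 0.
(* Compact subsets of a Hausdorff space are closed, so O is open. Together with the chart domain it
   covers M, and psi is smooth on each of the two. *)
pose O := ~` (cinv j @` K).
have oO : open O.
  by apply: closed_openC; apply: compact_closed => //; exact: m_hausdorff.
have psiO y : O y -> psi y = 0.
  move=> Oy; rewrite /psi; case: asboolP => // jy; apply: flat_le0.
  have : ~ K (cmap j y).
    by move=> Ky; apply: Oy; exists (cmap j y) => //; rewrite cmapK.
  rewrite /K closed_ballE // /closed_ball_ /= => /negP; rewrite -ltNge => ry.
  (* The norm is the maximum norm: outside K a single coordinate already differs by more than r, so
     the sum of squares in H exceeds r^2. *)
  have [//|k Ek] := @mx_norm_neq0 _ _ _ (y0 - cmap j y).
    by rewrite gt_eqF // (lt_trans r0).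
  have {}ry : r%:num < `|cmap j y 0 k.2 - y0 0 k.2|.
    have := ry; rewrite [`|_|]Ek !mxE distrC.
    by have -> : k.1 = 0 by exact: ord1.
  rewrite subr_le0 (bigD1 k.2) //= -[leLHS]addr0 lerD //.
    by rewrite -[leRHS]real_normK ?num_real // !expr2 ler_pM ?ltW.
  by apply: sumr_ge0 => l _; exact: sqr_ge0.
have spsi : smoothM setT psi.
  apply: smoothM_local => z _; have [jz|njz] := pselect (cdom j z).
    exists (cdom j) => // i k.
    have oI := @cimg_openI _ M i _ (@cdom_open _ M j).
    apply: (@Ck_eq _ _ _ _ (flat 0 \o (fun y : 'rV[R]_(mdim M) =>
       r%:num ^+ 2 + (-1) * \sum_(k < mdim M)
         ((cmap j (cinv i y) 0 k + - y0 0 k) * (cmap j (cinv i y) 0 k + - y0 0 k))))).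
    - exact: oI.
    - move=> _ [y [iy jy] <-] /=; rewrite /psi (cmapK iy).
      case: asboolP => // _; by rewrite /H mulN1r.
    - apply: Ck_comp => //; first exact: flat_smooth.
      apply: CkD => //; first exact: Ck_cst.
      apply: CkM => //; first exact: Ck_cst.
      elim: (index_enum _) => [|l s IHs].
        by rewrite (_ : (fun _ => _) = fun=> 0); [exact: Ck_cst|apply/funext => y; rewrite big_nil].
      rewrite (_ : (fun _ => _) = fun y : 'rV[R]_(mdim M) =>
         (cmap j (cinv i y) 0 l + - y0 0 l) * (cmap j (cinv i y) 0 l + - y0 0 l)
         + \sum_(k <- s) ((cmap j (cinv i y) 0 k + - y0 0 k) * (cmap j (cinv i y) 0 k + - y0 0 k)));
        last by apply/funext => y; rewrite big_cons.
      apply: CkD => //; apply: CkM => //; apply: CkD => //;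
        by [exact: ctransition|exact: Ck_cst].
  exists O; last first.
    apply: smoothM_eq (@smoothM_cst _ M O 0) => // y Oy.
    by rewrite psiO.
  move=> [y Ky zE]; apply: njz; rewrite -zE.
  by have [w [jw Uw] <-] := rW y Ky; rewrite cmapK.
exists (SmoothFun spsi); split.
  rewrite /= /psi; case: asboolP => // _; rewrite gt_eqF // flat_gt0 // /H.
  rewrite big1 ?subr0 ?exprn_gt0 // => k _.
  by rewrite subrr expr0n.
exists O => //; split=> // y; have [Oy|] := pselect (O y); first by left.
move=> /contrapT[z Kz <-]; right.
by have [w [jw Uw] <-] := rW z Kz; rewrite cmapK.
Qed.

End BumpFunctions.

(** * Exterior algebra *)

Section LinearMaps.
Context {R : pzRingType} {U V : lmodType R} (D : U -> V) (hD : linear D).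

Lemma linD P Q : D (P + Q) = D P + D Q.
Proof. by have := hD 1 P Q; rewrite !scale1r. Qed.

Lemma lin0 : D 0 = 0.
Proof. by have := linD 0 0; rewrite addr0 => /esym/eqP; rewrite -subr_eq0 addrK => /eqP. Qed.

Lemma linZ c P : D (c *: P) = c *: D P.
Proof. by have := hD c P 0; rewrite lin0 !addr0. Qed.

Lemma linN P : D (- P) = - D P.
Proof. by rewrite -scaleN1r linZ scaleN1r. Qed.

Lemma lin_sum (I : Type) (r : seq I) (p : pred I) F :
  D (\sum_(i <- r | p i) F i) = \sum_(i <- r | p i) D (F i).
Proof. exact: (big_morph D linD lin0). Qed.
End LinearMaps.

Section ExteriorAlgebra.
Context {R : realType} {F : vectType R}.
Local Notation form := (seq 'Hom(F, R^o) -> R).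
Implicit Types (P Q S : form) (s t u : seq 'Hom(F, R^o)).

Lemma ewedge_nil P Q : ewedge P Q [::] = P [::] * Q [::].
Proof. by rewrite /ewedge big_seq1 /= expr0 mul1r. Qed.

Lemma ewedge_linl (c : R) P Q S s :
  ewedge (fun u => c * P u + Q u) S s = c * ewedge P S s + ewedge Q S s.
Proof.
rewrite /ewedge mulr_sumr -big_split; apply: eq_bigr => m _ /=; ring.
Qed.

Lemma ewedge_linr (c : R) P Q S s :
  ewedge S (fun u => c * P u + Q u) s = c * ewedge S P s + ewedge S Q s.
Proof.
rewrite /ewedge mulr_sumr -big_split; apply: eq_bigr => m _ /=; ring.
Qed.

Lemma ewedge0l P s : ewedge (fun=> 0) P s = 0.
Proof. by rewrite /ewedge big1 // => m _; rewrite mul0r mulr0. Qed.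

Lemma size_mask_negb (T : Type) (m : bitseq) (s : seq T) : size m = size s ->
  size s = (size (mask m s) + size (mask (map negb m) s))%N.
Proof. by move=> sm; rewrite !size_mask ?size_map // count_map -sm -(count_predC id m). Qed.

(** By [ewedge_cons], evaluation on a first covector is an antiderivation of the product, and both
    sides satisfy the same recursion on the list of covectors. *)
Lemma ewedgeA P Q S s : ewedge (ewedge P Q) S s = ewedge P (ewedge Q S) s.
Proof.
elim: s P Q S => [|a s IH] P Q S; first by rewrite !ewedge_nil mulrA.
rewrite !ewedge_cons.
have -> : (fun u => ewedge P Q (a :: u)) =
    (fun u => 1 * ewedge (fun u => P (a :: u)) Q u +
       ewedge (fun u => (-1) ^+ size u * P u) (fun u => Q (a :: u)) u).
  by apply/funext => u; rewrite mul1r ewedge_cons.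
have -> : (fun u => ewedge Q S (a :: u)) =
    (fun u => 1 * ewedge (fun u => Q (a :: u)) S u +
       ewedge (fun u => (-1) ^+ size u * Q u) (fun u => S (a :: u)) u).
  by apply/funext => u; rewrite mul1r ewedge_cons.
rewrite ewedge_linl ewedge_linr !IH !mul1r -!addrA; congr (_ + (_ + _)).
(* The twist by (-1)^size is multiplicative, the sizes of the two complementary sublists adding
   up. *)
rewrite -IH; congr (ewedge _ _ _); apply/funext => u.
rewrite /ewedge mulr_sumr; apply: eq_big_seq => m /size_masks sm.
rewrite {1}(size_mask_negb sm) exprD; ring.
Qed.

Lemma ewedge_theta (c : R) P Q s :
  c ^+ size s * ewedge P Q s =
  ewedge (fun u => c ^+ size u * P u) (fun u => c ^+ size u * Q u) s.
Proof.
rewrite /ewedge mulr_sumr; apply: eq_big_seq => m /size_masks sm.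
rewrite {1}(size_mask_negb sm) exprD; ring.
Qed.

(** Only parities enter the sign, so P and Q may mix several degrees of the same parity. The
    antiderivation rule changes one parity at a time. *)
Lemma ewedgeC (p q : bool) P Q s :
  (forall u, odd (size u) != p -> P u = 0) ->
  (forall u, odd (size u) != q -> Q u = 0) ->
  ewedge P Q s = (-1) ^+ (p && q) * ewedge Q P s.
Proof.
have sgn (b : bool) S : (forall u, odd (size u) != b -> S u = 0) ->
    (fun u => (-1) ^+ size u * S u) = (fun u => (-1) ^+ b * S u + 0).
  move=> hS; apply/funext => u; rewrite addr0.
  have [<-|ne] := eqVneq (odd (size u)) b; first by rewrite signr_odd.
  by rewrite hS // !mulr0.
have con (b : bool) S a : (forall u, odd (size u) != b -> S u = 0) ->
    forall u, odd (size u) != ~~ b -> S (a :: u) = 0.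
  by move=> hS u hu; apply: hS => /=; case: (odd _) b hu => [] [].
elim: s p q P Q => [|a s IH] p q P Q hP hQ.
  rewrite !ewedge_nil.
  by case: p hP => hP; [rewrite hP // !(mul0r, mulr0)|rewrite /= expr0 mul1r mulrC].
rewrite !ewedge_cons (sgn _ _ hP) (sgn _ _ hQ) !ewedge_linl !ewedge0l !addr0.
rewrite (IH _ _ _ _ (con _ _ a hP) hQ) (IH _ _ _ _ hP (con _ _ a hQ)).
by case: p q {hP hQ} => [] [] /=; ring.
Qed.

Lemma ewedge_scalar P Q s : (forall u, u != [::] -> P u = 0) ->
  ewedge P Q s = P [::] * Q s.
Proof.
elim: s P Q => [|a s IH] P Q hP; first by rewrite ewedge_nil.
have Pa : (fun u => P (a :: u)) = fun=> 0 by apply/funext => u; rewrite hP.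
rewrite ewedge_cons Pa ewedge0l add0r IH /= ?expr0 ?mul1r //.
by move=> u u0; rewrite hP // mulr0.
Qed.

Section Alternating.
Context (P : form) (eP : exterior P).

Lemma exterior0 s t : P (s ++ 0 :: t) = 0.
Proof.
have := eP.1 s t (-1) 0 0; rewrite scaler0 addr0 mulN1r => ->.
by rewrite addNr.
Qed.

Lemma exterior_sum (I : Type) (r : seq I) (c : I -> R) x s t :
  P (s ++ \sum_(i <- r) c i *: x i :: t) = \sum_(i <- r) c i * P (s ++ x i :: t).
Proof.
elim: r => [|i r IH]; first by rewrite !big_nil exterior0.
by rewrite !big_cons eP.1 IH.
Qed.

Lemma exterior_swap s t a b : P (s ++ a :: b :: t) = - P (s ++ b :: a :: t).
Proof.
have l x y : P (s ++ (x + y) :: (a + b) :: t) =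
    P (s ++ x :: (a + b) :: t) + P (s ++ y :: (a + b) :: t).
  by have := eP.1 s ((a + b) :: t) 1 x y; rewrite scale1r mul1r.
have r x : P (s ++ x :: (a + b) :: t) = P (s ++ x :: a :: t) + P (s ++ x :: b :: t).
  have := eP.1 (rcons s x) t 1 a b.
  by rewrite scale1r mul1r -!cats1 -!catA.
have := eP.2 s t (a + b); rewrite l !r !eP.2 add0r addr0.
by move/eqP; rewrite addr_eq0 => /eqP.
Qed.

Lemma exterior_repeat s u t a : P (s ++ a :: u ++ a :: t) = 0.
Proof.
elim: u s => [|b u IH] s; first exact: eP.2.
by rewrite cat_cons exterior_swap -cat_rcons IH oppr0.
Qed.

(** A list longer than a generating family is dependent: some entry is a combination of later ones,
    and each term of the expansion repeats a covector. *)
Lemma exterior_dim (E : seq 'Hom(F, R^o)) s :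
  (forall b, b \in <<E>>%VS) -> (size E < size s)%N -> P s = 0.
Proof.
move=> genE ltEs.
have : ~~ free s.
  apply/negP => /eqP fs; move: ltEs; rewrite -fs ltnNge => /negP; apply.
  apply: leq_trans (dim_span E); apply: dimvS.
  by apply/subvP => b _; exact: genE.
have : forall s1, ~~ free s -> P (s1 ++ s) = 0; last by move/(_ [::]).
elim: (s) => [|a t IH] s1; first by rewrite nil_free.
rewrite free_cons negb_and negbK => /orP[|/IH]; last by rewrite -cat_rcons.
move=> ha; rewrite (@coord_span _ _ _ (in_tuple t) a ha).
rewrite exterior_sum big1 // => i _.
have rep y : y \in t -> P (s1 ++ y :: t) = 0.
  by case/splitPr => u v; rewrite exterior_repeat.
by rewrite rep ?mulr0 // mem_nth.
Qed.

End Alternating.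

Definition evector (v : F) : form := fun u => if u is [:: xi] then xi v else 0.

(** Euler identity: contracting with a coframe and multiplying back by the dual frame counts the
    degree. Evaluation on b gives b(e_a) times a contraction, which sums to the contraction with b,
    plus the same identity for the contraction of P with b. *)
Lemma exterior_euler (I : finType) (e : I -> F) (d : I -> 'Hom(F, R^o)) P s :
  (forall b : 'Hom(F, R^o), b = \sum_a (b (e a) : R) *: d a) -> exterior P ->
  \sum_a ewedge (evector (e a)) (fun u => P (d a :: u)) s = (size s)%:R * P s.
Proof.
move=> frame; elim: s P => [|b s IH] P eP.
  by rewrite big1 ?mul0r // => a _; rewrite ewedge_nil mul0r.
have step a : ewedge (evector (e a)) (fun u => P (d a :: u)) (b :: s) =
    b (e a) * P (d a :: s) + ewedge (evector (e a)) (fun u => P (b :: d a :: u)) s.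
  rewrite ewedge_cons; congr (_ + _).
    by rewrite ewedge_scalar //; case.
  have -> : (fun u => (-1) ^+ size u * evector (e a) u) =
      (fun u => -1 * evector (e a) u + 0).
    by apply/funext => -[|x [|y u]] /=; rewrite ?expr1 ?mulr0 ?addr0.
  have -> : (fun u => P (d a :: b :: u)) = (fun u => -1 * P (b :: d a :: u) + 0).
    by apply/funext => u; rewrite addr0 mulN1r; exact: (exterior_swap eP [::]).
  rewrite ewedge_linl ewedge_linr.
  have z S : ewedge S (fun=> 0) s = 0.
    by rewrite /ewedge big1 // => m _; rewrite !mulr0.
  by rewrite !z ewedge0l; ring.
rewrite (eq_bigr _ (fun a _ => step a)) big_split /=.
rewrite (IH (fun u => P (b :: u))); last exact: exterior_cons.
have <- := exterior_sum eP _ _ _ [::]; rewrite /= -frame.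
by rewrite -[size s]/(size s) -natr1; ring.
Qed.

End ExteriorAlgebra.

(** * Multivector fields *)

Section MultivectorAlgebra.
Context {R : realType} {M : manifold R} (A : vbundle M).
Local Notation V := (mvect A).
Local Notation fn := (mvfun A).
Local Notation "P /\_ Q" := (mvwedge P Q) (at level 40, left associativity).
Implicit Types (P Q S : V) (f g : smoothfun M) (X Y : sect A) (x y : M).

Lemma ewedge_scalarr (F : vectType R) (P Q : seq 'Hom(F, R^o) -> R) s :
  (forall u, u != [::] -> Q u = 0) -> ewedge P Q s = P s * Q [::].
Proof.
elim: s P Q => [|a s IH] P Q hQ; first by rewrite ewedge_nil.
have Qa : (fun u => Q (a :: u)) = fun=> 0 by apply/funext => u; rewrite hQ.
by rewrite ewedge_cons Qa IH // /ewedge addrC big1 ?add0r // => m _; rewrite !mulr0.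
Qed.

Lemma mvDE P Q x s : (P + Q) x s = P x s + Q x s. Proof. by []. Qed.

Lemma mvZE (c : R) P x s : (c *: P) x s = c * P x s. Proof. by []. Qed.

Lemma mvNE P x s : (- P) x s = - P x s. Proof. exact: mulN1r. Qed.

Lemma mv0E x s : (0 : V) x s = 0. Proof. by []. Qed.

Lemma mv_sumE (I : Type) (r : seq I) (p : pred I) (F : I -> V) x s :
  (\sum_(i <- r | p i) F i) x s = \sum_(i <- r | p i) F i x s.
Proof. exact: (big_morph (fun P : V => P x s) (fun _ _ => erefl) erefl). Qed.

Lemma mvwedgeE P Q x s : (P /\_ Q) x s = ewedge (P x) (Q x) s. Proof. by []. Qed.

Lemma mvwedge_linl Q : linear (fun P => P /\_ Q).
Proof. by move=> c P S; apply: mv_eq => x s; exact: ewedge_linl. Qed.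

Lemma mvwedge_linr P : linear (fun Q => P /\_ Q).
Proof. by move=> c Q S; apply: mv_eq => x s; exact: ewedge_linr. Qed.

Definition mvwedgeDl P Q S := linD (mvwedge_linl S) P Q.
Definition mvwedgeDr P Q S := linD (mvwedge_linr S) P Q.
Definition mvwedgeNl P Q := linN (mvwedge_linl Q) P.
Definition mvwedgeNr P Q := linN (mvwedge_linr P) Q.
Definition mvwedgeZl c P Q := linZ (mvwedge_linl Q) c P.
Definition mvwedgeZr c P Q := linZ (mvwedge_linr P) c Q.
Definition mvwedge0l Q := lin0 (mvwedge_linl Q).
Definition mvwedge0r P := lin0 (mvwedge_linr P).

Lemma mvwedgeA P Q S : P /\_ (Q /\_ S) = P /\_ Q /\_ S.
Proof. by apply: mv_eq => x s; rewrite /= ewedgeA. Qed.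

Lemma mvfun_wedgeE f P x s : (fn f /\_ P) x s = f x * P x s.
Proof. by rewrite mvwedgeE ewedge_scalar //; case. Qed.

Lemma mvfun_wedgeC f P : P /\_ fn f = fn f /\_ P.
Proof.
apply: mv_eq => x s; rewrite mvfun_wedgeE mvwedgeE ewedge_scalarr; last by case.
by rewrite mulrC.
Qed.

Lemma mvfun_wedgeCA f P Q : P /\_ (fn f /\_ Q) = fn f /\_ (P /\_ Q).
Proof. by rewrite !mvwedgeA mvfun_wedgeC. Qed.

Lemma mvfun1_wedge P : fn 1 /\_ P = P.
Proof. by apply: mv_eq => x s; rewrite mvfun_wedgeE mul1r. Qed.

Lemma mvwedge_mvfun1 P : P /\_ fn 1 = P.
Proof. by rewrite mvfun_wedgeC mvfun1_wedge. Qed.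

Lemma mvfunD f g : fn (f + g) = fn f + fn g.
Proof. by apply: mv_eq => x [|a s] //=; rewrite addr0. Qed.

Lemma mvfunN f : fn (- f) = - fn f.
Proof. by apply: mv_eq => x [|a s]; rewrite mvNE //= oppr0. Qed.

Lemma mvfun0 : fn 0 = 0.
Proof. by apply: mv_eq => x []. Qed.

Lemma mvsectD X Y : mvsect (X + Y) = mvsect X + mvsect Y.
Proof. by apply: mv_eq => x [|a [|b s]] //=; rewrite ?addr0 ?linearD. Qed.

Lemma mvsectN X : mvsect (- X) = - mvsect X.
Proof. by apply: mv_eq => x [|a [|b s]]; rewrite mvNE //= ?oppr0 ?linearN. Qed.

Lemma wedges1 X : wedges [:: X] = mvsect X.
Proof. exact: mvwedge_mvfun1. Qed.

Fact theta_exterior (c : R) P x : exterior (fun s => c ^+ size s * P x s).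
Proof.
have [lP aP] := mv_exterior P x; split=> [s t d a b|s t a]; last by rewrite aP mulr0.
by rewrite !lP !size_cat /=; ring.
Qed.
Fact theta_smooth (c : R) P :
  smooth_multivector (fun x s => c ^+ size s * P x s).
Proof.
move=> i J; rewrite (_ : (fun _ => _) = fun x =>
    c ^+ size J * P x [seq coframe i x a | a <- J]); last first.
  by apply/funext => x; rewrite size_map.
exact: smoothMM (tdom_open i) (smoothM_cst _ _) (mv_smooth P i J).
Qed.

(* For c <> 0, the algebra automorphism acting by c^p in degree p; an operator
   is homogeneous when it commutes with all of them up to a power of c. *)
Definition theta c P : V := MVect (theta_exterior c P) (theta_smooth c P).

Lemma thetaE c P x s : theta c P x s = c ^+ size s * P x s. Proof. by []. Qed.

Lemma theta_lin c : linear (theta c).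
Proof. by move=> d P Q; apply: mv_eq => x s; rewrite /= mulrDr mulrCA. Qed.

Lemma theta_wedge c P Q : theta c (P /\_ Q) = theta c P /\_ theta c Q.
Proof. by apply: mv_eq => x s; exact: ewedge_theta. Qed.

Lemma theta_theta c d P : theta c (theta d P) = theta (c * d) P.
Proof. by apply: mv_eq => x s; rewrite !thetaE exprMn mulrA. Qed.

Lemma theta1 P : theta 1 P = P.
Proof. by apply: mv_eq => x s; rewrite thetaE expr1n mul1r. Qed.

Lemma theta_fun c f : theta c (fn f) = fn f.
Proof. by apply: mv_eq => x [|a s]; rewrite thetaE /= ?mul1r ?mulr0. Qed.

Lemma theta_sect c X : theta c (mvsect X) = c *: mvsect X.
Proof. by apply: mv_eq => x [|a [|b s]]; rewrite thetaE mvZE //= ?mulr0. Qed.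

Lemma theta_wedges c (s : seq (sect A)) : theta c (wedges s) = c ^+ size s *: wedges s.
Proof.
elim: s => [|X s IH] /=; first by rewrite theta_fun scale1r.
by rewrite theta_wedge theta_sect IH mvwedgeZl mvwedgeZr scalerA exprS.
Qed.

Lemma multivectorP p P :
  multivector p P <-> (forall x s, size s != p -> P x s = 0).
Proof.
by split=> h x s hs; apply: h; move: hs; rewrite (inj_eq (addIr _)) eqz_nat.
Qed.

Lemma theta_multivector c p P : multivector p P -> theta c P = c ^+ p *: P.
Proof.
move/multivectorP => hP; apply: mv_eq => x s; rewrite thetaE mvZE.
by have [->|ne] := eqVneq (size s) p; last by rewrite hP // !mulr0.
Qed.

(** The powers of 2 are distinct, so a single scaling automorphism separates all degrees. *)
Lemma multivector_theta2 p P : theta 2 P = 2 ^+ p *: P -> multivector p P.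
Proof.
move=> hP; apply/multivectorP => x s ne.
have := congr1 (fun Q : V => Q x s) hP; rewrite thetaE mvZE => /eqP.
rewrite -subr_eq0 -mulrBl mulf_eq0 => /orP[|/eqP//].
by rewrite subr_eq0 -!natrX eqr_nat eqn_exp2l // (negbTE ne).
Qed.

Lemma component_multivector p P : multivector p (component (p%:Z - 2) P).
Proof.
apply/multivectorP => x s ne /=; rewrite /component_val.
by rewrite (inj_eq (addIr _)) eqz_nat (negbTE ne).
Qed.

Section Frames.
Variables (i : trivialisation A) (x : M) (ix : tdom i x).
Let e (a : 'I_(rank A)) := (triv i x)^-1%VF (delta_mx 0 a).

Lemma trivK v : (triv i x)^-1%VF (triv i x v) = v.
Proof.
apply: lker0_lfunK; apply/lker0P.
exact: bij_inj (triv_bij ix).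
Qed.

Lemma coframe_dual (b : 'Hom(fiber A x, R^o)) :
  b = \sum_a (b (e a) : R) *: coframe i x a.
Proof.
apply/lfunP => v; rewrite sum_lfunE -[in LHS](trivK v).
rewrite [in LHS](row_sum_delta (triv i x v)) !linear_sum; apply: eq_bigr => a _.
by rewrite !linearZ scale_lfunE coframeE [RHS]mulrC.
Qed.

Lemma mv_rank P s : (rank A < size s)%N -> P x s = 0.
Proof.
move=> hs; pose E := [seq coframe i x a | a <- enum 'I_(rank A)].
apply: (exterior_dim (mv_exterior P x) (E := E)); last first.
  by rewrite size_map size_enum_ord.
move=> b; rewrite (coframe_dual b); apply: memv_suml => a _.
by apply/memvZ/memv_span/map_f; rewrite mem_enum.
Qed.
End Frames.

Lemma mv_rank_size P x s : (rank A < size s)%N -> P x s = 0.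
Proof. by have [i ix] := @tdom_cover _ _ A x; exact: (mv_rank ix). Qed.

(** Components above the rank vanish, so the finite sums over degrees in [l2] and [insertion] lose
    nothing. *)
Lemma mv_components P :
  P = \sum_(k < (rank A).+1) component (k%:Z - 2) P.
Proof.
apply: mv_eq => x s; rewrite mv_sumE /= /component_val.
have [hs|hs] := ltnP (size s) (rank A).+1.
  rewrite (bigD1 (Ordinal hs)) //= eqxx big1 ?addr0 // => k ne.
  rewrite (inj_eq (addIr _)) eqz_nat ifF //; apply/negbTE.
  by apply: contra ne => /eqP E; apply/eqP/val_inj.
rewrite mv_rank_size // big1 // => k _.
by rewrite if_same.
Qed.

Lemma multivector0_fun P : multivector 0 P -> exists f, P = fn f.
Proof.
move/multivectorP => hP.
have sP : smoothM setT (fun x => P x [::]).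
  apply: smoothM_local => x _; have [i ix] := @tdom_cover _ _ A x.
  by exists (tdom i) => //; have := mv_smooth P i [::].
by exists (SmoothFun sP); apply: mv_eq => x [|a s] //=; rewrite hP.
Qed.

(** * Global frames and contractions cut off by a bump function *)

Section Localisation.
Variables (i : trivialisation A) (psi : smoothfun M) (O : set M).
Hypotheses (oO : open O) (psiO : forall y, O y -> psi y = 0)
  (cover : forall y, O y \/ tdom i y).

(** The extension by zero is smooth because every point lies either in O, where psi vanishes, or in
    the domain of the trivialisation. *)
Definition frame_val (a : 'I_(rank A)) y : fiber A y :=
  if `[< tdom i y >] then psi y *: (triv i y)^-1%VF (delta_mx 0 a) else 0.

Fact frame_smooth a : smooth_section (frame_val a).
Proof.
move=> j b; apply: smoothM_local => y jy; have [Oy|iy] := cover y.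
  exists (O `&` tdom j) => //; have oW := openI oO (tdom_open j).
  apply: smoothM_eq oW _ (smoothM_cst _ 0) => z [Oz jz].
  by rewrite /frame_val psiO // scale0r if_same linear0 mxE.
exists (tdom i `&` tdom j) => //; have oW := openI (tdom_open i) (tdom_open j).
apply: smoothM_eq oW _
  (smoothMM oW (smoothMW (smoothfunP psi) oW) (ttransition i j a b)) => z [iz jz].
by rewrite /frame_val; case: asboolP => // _; rewrite linearZ mxE.
Qed.

Definition frame a := Sect (frame_smooth a).

Definition contract_val (a : 'I_(rank A)) P y (s : seq 'Hom(fiber A y, R^o)) : R :=
  if `[< tdom i y >] then psi y * P y (coframe i y a :: s) else 0.

Fact contract_exterior a P y : exterior (@contract_val a P y).
Proof.
have [lP aP] := mv_exterior P y; rewrite /contract_val.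
split=> [s t c b d|s t b]; case: asboolP => _; rewrite ?mulr0 ?addr0 //.
  by rewrite (lP (_ :: s)); rewrite /=; ring.
by rewrite (aP (_ :: s)) mulr0.
Qed.

Fact contract_smooth a P : smooth_multivector (@contract_val a P).
Proof.
move=> j J; apply: smoothM_local => y jy; have [Oy|iy] := cover y.
  exists (O `&` tdom j) => //; have oW := openI oO (tdom_open j).
  apply: smoothM_eq oW _ (smoothM_cst _ 0) => z [Oz jz].
  by rewrite /contract_val psiO // mul0r if_same.
exists (tdom j `&` tdom i) => //; have oW := openI (tdom_open j) (tdom_open i).
(* The covector of the coframe of i is expanded in the coframe of j; its coefficients are transition
   functions, hence smooth. *)
have sS : smoothM (tdom j `&` tdom i) (fun z => \sum_b
    triv i z ((triv j z)^-1%VF (delta_mx 0 b)) 0 a *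
      P z [seq coframe j z c | c <- b :: J]).
  apply: (smoothM_sum _ oW) => b; apply: (smoothMM oW (ttransition j i b a)).
  by apply: smoothM_sub (mv_smooth P j (b :: J)) => z [].
apply: smoothM_eq oW _ (smoothMM oW (smoothMW (smoothfunP psi) oW) sS) => z [jz iz].
rewrite /contract_val; case: asboolP => // _; congr (_ * _).
rewrite (coframe_dual jz (coframe i z a)) (exterior_sum (mv_exterior P z) _ _ _ [::]).
by apply: eq_bigr => b _; rewrite coframeE.
Qed.

Definition contract a P := MVect (contract_exterior a P) (contract_smooth a P).

(** The Euler identity with two factors psi, one carried by the frame and one by the contraction.
    Where the trivialisation is not defined, psi vanishes and so do both sides. *)
Lemma frame_contract p P : multivector p P ->
  p%:R *: (fn psi /\_ (fn psi /\_ P)) = \sum_a mvsect (frame a) /\_ contract a P.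
Proof.
move/multivectorP => hP; apply: mv_eq => y s.
rewrite mvZE !mvfun_wedgeE mv_sumE.
have [iy|niy] := pselect (tdom i y); last first.
  have Oy : O y by case: (cover y).
  rewrite (psiO Oy) !(mul0r, mulr0) big1 // => a _.
  rewrite mvwedgeE -[RHS](ewedge0l (contract a P y) s); congr ewedge.
  apply/funext => -[|b [|c u]] //=.
  by rewrite /frame_val; case: asboolP => // _; rewrite linear0.
have E a : (mvsect (frame a) /\_ contract a P) y s = psi y * (psi y *
    ewedge (evector ((triv i y)^-1%VF (delta_mx 0 a)))
      (fun u => P y (coframe i y a :: u)) s).
  have E1 : mvsect (frame a) y =
      (fun u => psi y * evector ((triv i y)^-1%VF (delta_mx 0 a)) u + 0).
    apply/funext => -[|b [|c u]] /=; rewrite ?mulr0 ?addr0 //.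
    by rewrite /frame_val; case: asboolP => // _; rewrite linearZ.
  have E2 : contract a P y = (fun u => psi y * P y (coframe i y a :: u) + 0).
    by apply/funext => u; rewrite /= /contract_val addr0; case: asboolP.
  have z (T : seq 'Hom(fiber A y, R^o) -> R) : ewedge T (fun=> 0) s = 0.
    by rewrite ewedge_scalarr // mulr0.
  by rewrite mvwedgeE E1 E2 ewedge_linl ewedge_linr z ewedge0l !addr0.
rewrite (eq_bigr _ (fun a _ => E a)) -!mulr_sumr.
rewrite (exterior_euler s (coframe_dual iy) (mv_exterior P y)).
have [<-|ne] := eqVneq (size s) p; first by ring.
by rewrite hP // !mulr0.
Qed.

Lemma contract_multivector a p P : multivector p.+1 P -> multivector p (contract a P).
Proof.
move/multivectorP => hP; apply/multivectorP => y s ne /=.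
by rewrite /contract_val hP ?mulr0 ?if_same.
Qed.

End Localisation.

(* By [frame_contract], the square of a bump function times P is a combination
   of products of a section and a contraction of P, of lower degree. *)
Lemma tensor_ext (D : V -> V) : linear D ->
  (forall f P, D (fn f /\_ P) = fn f /\_ D P) ->
  (forall s : seq (sect A), D (wedges s) = 0) -> forall P, D P = 0.
Proof.
move=> lD tD wD P; rewrite (mv_components P) (lin_sum lD) big1 // => k _.
move: (@component_multivector k P); move: (component _ P) => {}P.
elim: (nat_of_ord k) D lD tD wD P => [|p IH] D lD tD wD P hP.
  have [f ->] := multivector0_fun hP.
  by rewrite -[fn f]mvwedge_mvfun1 tD (wD [::]) mvwedge0r.
apply: mv_eq => x s; rewrite mv0E.
have [i ix] := @tdom_cover _ _ A x.
have [psi [psix [W oW [psiW cover]]]] := bump_function (tdom_open i) ix.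
have := congr1 D (frame_contract oW psiW cover hP).
rewrite (linZ lD) !tD (lin_sum lD) big1 => [|a _]; last first.
  (* The induction runs over all D at once: D precomposed with the product by a section is again
     linear, tensorial and zero on products of sections. *)
  apply: (IH (fun Q => D (mvsect (frame oW psiW cover a) /\_ Q))).
  - by move=> c Q S; rewrite mvwedge_linr lD.
  - by move=> f Q; rewrite mvfun_wedgeCA tD.
  - by move=> t; exact: (wD (_ :: t)).
  - exact: contract_multivector.
move/(congr1 (fun Q : V => Q x s)) => /eqP; rewrite mvZE !mvfun_wedgeE mv0E.
by rewrite !mulf_eq0 pnatr_eq0 (negbTE psix) /= => /eqP.
Qed.

End MultivectorAlgebra.

Ltac mvring := apply: mv_eq => ? ?; rewrite !(mvDE, mvNE, mvZE, mv0E); ring.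

(** * Derivations and biderivations *)

Section Derivations.
Context {R : realType} {M : manifold R} {A : vbundle M}.
Local Notation V := (mvect A).
Local Notation fn := (mvfun A).
Local Notation "P /\_ Q" := (mvwedge P Q) (at level 40, left associativity).
Local Notation eps := (theta (-1)).
Implicit Types (P Q S : V) (D : V -> V) (f g : smoothfun M) (X Y : sect A).
Implicit Types (b d p q r : bool).

(** Signs are kept as booleans, so that sign identities are settled by case analysis. *)
Definition sg b P : V := if b then - P else P.

Lemma sg_sg b d P : sg b (sg d P) = sg (b (+) d) P.
Proof. by case: b; case: d => //=; rewrite opprK. Qed.

Lemma sg0 b : sg b 0 = 0.
Proof. by case: b => //=; rewrite oppr0. Qed.

Lemma lin_sg D b P : linear D -> D (sg b P) = sg b (D P).
Proof. by move=> lD; case: b => //=; rewrite (linN lD). Qed.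

Definition par b P := forall x s, odd (size s) != b -> P x s = 0.

Lemma par_eps b P : par b P <-> eps P = sg b P.
Proof.
split=> [hP|hP x s ne].
  apply: mv_eq => x s; rewrite thetaE -signr_odd.
  have [<-|ne] := eqVneq (odd (size s)) b.
    by case: (odd _); rewrite /sg /= ?mvNE ?expr1 ?mulN1r ?mul1r.
  have -> : sg b P x s = (-1) ^+ b * P x s.
    by case: b {hP ne}; rewrite /sg /= ?mvNE ?expr1 ?mulN1r ?mul1r.
  by rewrite hP // !mulr0.
have := congr1 (fun Q : V => Q x s) hP; rewrite thetaE -signr_odd.
by case: b {hP} ne; case: (odd _) => // _; rewrite /sg /= ?mvNE ?expr1 ?mul1r ?mulN1r => h; lra.
Qed.

Lemma par_epsE b P : par b P -> eps P = sg b P.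
Proof. by move/par_eps. Qed.

Lemma par_fun f : par false (fn f).
Proof. by move=> x [|a s]. Qed.

Lemma par_sect X : par true (mvsect X).
Proof. by move=> x [|a [|b s]]. Qed.

Lemma par_sg b d P : par b P -> par b (sg d P).
Proof. by move=> hP x s ne; case: d; rewrite /= ?mulN1r hP ?oppr0. Qed.

Lemma par_split P : exists P0 P1, [/\ par false P0, par true P1 & P = P0 + P1].
Proof.
exists (2^-1 *: (P + eps P)), (2^-1 *: (P - eps P)); split.
- apply/par_eps; rewrite (linZ (theta_lin _)) (linD (theta_lin _)).
  by rewrite theta_theta mulrNN mulr1 theta1 addrC.
- apply/par_eps; rewrite (linZ (theta_lin _)) (linD (theta_lin _)) (linN (theta_lin _)).
  by rewrite theta_theta mulrNN mulr1 theta1 /sg -scalerN opprB addrC.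
- by apply: mv_eq => x s; rewrite mvDE !mvZE !mvDE mvNE; lra.
Qed.

Lemma par_wedge p q P Q : par p P -> par q Q -> par (p (+) q) (P /\_ Q).
Proof.
move=> /par_eps hP /par_eps hQ; apply/par_eps; rewrite theta_wedge hP hQ.
by case: p {hP}; case: q {hQ}; rewrite /= ?(mvwedgeNl, mvwedgeNr, opprK).
Qed.

Lemma par_multivector (k : nat) P : multivector k P -> par (odd k) P.
Proof.
move/multivectorP => hP x s; have [->|ne _] := eqVneq (size s) k; last exact: hP.
by rewrite eqxx.
Qed.

Lemma mvwedgeC p q P Q : par p P -> par q Q -> P /\_ Q = sg (p && q) (Q /\_ P).
Proof.
move=> hP hQ; apply: mv_eq => x s; rewrite mvwedgeE.
rewrite (@ewedgeC _ _ p q); [|by move=> u; apply: hP|by move=> u; apply: hQ].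
by case: (p && q); rewrite /sg ?mvNE /= ?expr1 ?mulN1r ?mul1r.
Qed.

(** The Koszul sign for an operator of parity d passing P, in a form that makes sense when P is not
    homogeneous. *)
Definition tw d P : V := if d then eps P else P.

Record derivation d D : Prop := Derivation {
  der_lin : linear D;
  der_mul : forall Q S, D (Q /\_ S) = D Q /\_ S + tw d Q /\_ D S
}.

Definition parity d D := forall Q, D (eps Q) = sg d (eps (D Q)).

Lemma tw_fun d f : tw d (fn f) = fn f.
Proof. by case: d; rewrite /= ?theta_fun. Qed.

Lemma tw_tw b d P : tw b (tw d P) = tw (b (+) d) P.
Proof.
case: b; case: d; rewrite /= ?theta_theta ?mulrNN ?mulr1 ?theta1 //.
Qed.

Lemma tw_par b d P : par b P -> tw d P = sg (b && d) P.
Proof. by move/par_eps => h; case: d; rewrite /= ?h ?andbT ?andbF. Qed.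

Lemma der0 d D : derivation d D -> (forall f, D (fn f) = 0) ->
  (forall X, D (mvsect X) = 0) -> forall P, D P = 0.
Proof.
move=> [lD mD] Df DX; apply: tensor_ext => //.
  by move=> f P; rewrite mD Df mvwedge0l add0r tw_fun.
elim=> [|X s IH] /=; first exact: Df.
by rewrite -/(wedges s) mD DX IH mvwedge0l mvwedge0r addr0.
Qed.

Lemma der_linear_comb d (c : R) D1 D2 : derivation d D1 -> derivation d D2 ->
  derivation d (fun Q => c *: D1 Q + D2 Q).
Proof.
move=> [l1 m1] [l2 m2]; split=> [e P Q|Q S].
  by rewrite l1 l2; mvring.
rewrite m1 m2 !(mvwedgeDl, mvwedgeDr, mvwedgeZl, mvwedgeZr); mvring.
Qed.

Lemma der_zero d : derivation d (fun=> 0).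
Proof.
split=> [c P Q|Q S]; first by rewrite scaler0 addr0.
by rewrite mvwedge0l mvwedge0r addr0.
Qed.

Lemma der_scale d (c : R) D : derivation d D -> derivation d (fun Q => c *: D Q).
Proof.
move=> hD; have := der_linear_comb c hD (der_zero d).
by congr derivation; apply/funext => Q; rewrite addr0.
Qed.

Lemma der_sg b d D : derivation d D -> derivation d (fun Q => sg b (D Q)).
Proof.
by case: b => //= /(der_scale (-1)).
Qed.

Lemma der_add d D1 D2 : derivation d D1 -> derivation d D2 ->
  derivation d (fun Q => D1 Q + D2 Q).
Proof.
move=> h1 h2; have := der_linear_comb 1 h1 h2.
by congr derivation; apply/funext => Q; rewrite scale1r.
Qed.

Lemma der_sub d D1 D2 : derivation d D1 -> derivation d D2 ->
  derivation d (fun Q => D1 Q - D2 Q).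
Proof. by move=> h1 /(der_sg true) h2; exact: der_add. Qed.

(** The mixed terms, in which each operator acts on a different factor, cancel because D1 and D2
    commute with [eps] up to their parities. *)
Lemma der_comm d1 d2 D1 D2 : derivation d1 D1 -> derivation d2 D2 ->
  parity d1 D1 -> parity d2 D2 ->
  derivation (d1 (+) d2) (fun Q => D1 (D2 Q) - sg (d1 && d2) (D2 (D1 Q))).
Proof.
move=> [l1 m1] [l2 m2] p1 p2; split=> [c P Q|Q S].
  by case: (_ && _) => /=; rewrite !(l1, l2); mvring.
rewrite m1 m2 (linD l1) (linD l2) !m1 !m2.
case: d1 d2 m1 m2 p1 p2 => [] [] m1 m2 p1 p2 /=;
rewrite ?(p1, p2) /= ?theta_theta ?mulrNN ?mulr1 ?theta1
  !(mvwedgeDl, mvwedgeDr, mvwedgeNl, mvwedgeNr); mvring.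
Qed.

(** Serves to prove homogeneity: D is homogeneous when its conjugate by [theta c] is a multiple of
    D, an equality of two derivations. *)
Lemma der_conj d D (c : R) : c != 0 -> derivation d D ->
  derivation d (fun Q => theta c^-1 (D (theta c Q))).
Proof.
move=> c0 [lD mD]; split=> [e P Q|Q S]; first by rewrite theta_lin lD theta_lin.
rewrite theta_wedge mD (linD (theta_lin _)) !theta_wedge theta_theta mulVf // theta1.
congr (_ + _ /\_ _); case: d {mD}; rewrite /= !theta_theta; last by rewrite mulVf ?theta1.
by rewrite mulrN1 mulNr mulVf.
Qed.

(* [bd_theta] says that B lowers the total degree by k. *)
Record bider (k : nat) (B : V -> V -> V) : Prop := Bider {
  bd_linl : forall Q, linear (fun P => B P Q);
  bd_linr : forall P, linear (B P);
  bd_sym : forall p q P Q, par p P -> par q Q -> B P Q = sg (p && q) (B Q P);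
  bd_theta : forall c P Q, c != 0 -> c ^+ k *: theta c (B P Q) = B (theta c P) (theta c Q);
  bd_mul : forall p P Q S, par p P ->
    B P (Q /\_ S) = B P Q /\_ S + tw (p (+) odd k) Q /\_ B P S
}.

Section Bider.
Variables (k : nat) (B : V -> V -> V) (hB : bider k B).

Lemma bd_der p P : par p P -> derivation (p (+) odd k) (B P).
Proof. by move=> hP; split=> [|Q S]; [exact: (bd_linr hB)|exact: (bd_mul hB)]. Qed.

Lemma scale_sign (n : nat) P : (-1) ^+ n *: P = sg (odd n) P.
Proof. by rewrite -signr_odd; case: (odd n); rewrite /= ?expr1 ?expr0 ?scaleN1r ?scale1r. Qed.

(** The case c = -1 of [bd_theta]. *)
Lemma bd_parity p P : par p P -> parity (p (+) odd k) (B P).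
Proof.
move=> /par_eps hP Q; have n1 : -1 != 0 :> R by rewrite oppr_eq0 oner_eq0.
have := bd_theta hB P Q n1.
rewrite scale_sign hP (lin_sg _ _ (bd_linl hB _)) => /(congr1 (sg p)).
by rewrite !sg_sg addbb.
Qed.

Lemma bd_par p q P Q : par p P -> par q Q -> par (p (+) q (+) odd k) (B P Q).
Proof.
move=> hP /par_eps hQ; apply/par_eps.
have := bd_parity hP Q; rewrite hQ (lin_sg _ _ (bd_linr hB _)).
move/(congr1 (sg (p (+) odd k))); rewrite !sg_sg addbb /= => <-.
by congr sg; case: p q (odd k) {hP hQ} => [] [] [].
Qed.

(** [der0] frees the second argument while the first is a function or a section; graded symmetry
    exchanges the two, and [der0] applies again. Parities, needed for both, are restored by
    splitting P into its even and odd parts. *)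
Lemma bd_eq0 : (forall f g, B (fn f) (fn g) = 0) ->
  (forall X f, B (mvsect X) (fn f) = 0) ->
  (forall X Y, B (mvsect X) (mvsect Y) = 0) -> forall P Q, B P Q = 0.
Proof.
move=> Bff BXf BXX.
have Bf f Q : B (fn f) Q = 0.
  apply: (der0 (bd_der (par_fun f))) => // X.
  by rewrite (bd_sym hB (par_fun f) (par_sect X)) /= BXf.
have BX X Q : B (mvsect X) Q = 0.
  by apply: (der0 (bd_der (par_sect X))).
have Bp p P Q : par p P -> B P Q = 0.
  move=> hP; apply: (der0 (bd_der hP)) => [f|X].
    by rewrite (bd_sym hB hP (par_fun f)) Bf sg0.
  by rewrite (bd_sym hB hP (par_sect X)) BX sg0.
move=> P Q; have [P0 [P1 [h0 h1 ->]]] := par_split P.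
by rewrite (linD (bd_linl hB Q)) (Bp _ _ _ h0) (Bp _ _ _ h1) addr0.
Qed.

End Bider.

Lemma bider_sub k B1 B2 : bider k B1 -> bider k B2 ->
  bider k (fun P Q => B1 P Q - B2 P Q).
Proof.
move=> h1 h2; split.
- by move=> Q c P S; rewrite (bd_linl h1) (bd_linl h2); mvring.
- by move=> P c Q S; rewrite (bd_linr h1) (bd_linr h2); mvring.
- move=> p q P Q hP hQ; rewrite (bd_sym h1 hP hQ) (bd_sym h2 hP hQ).
  by case: (_ && _) => //=; rewrite opprD.
- move=> c P Q c0; rewrite -(bd_theta h1) // -(bd_theta h2) //.
  by rewrite (linD (theta_lin _)) (linN (theta_lin _)) scalerDr scalerN.
- move=> p P Q S hP; rewrite (bd_mul h1 _ _ hP) (bd_mul h2 _ _ hP).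
  by rewrite !(mvwedgeDl, mvwedgeDr, mvwedgeNl, mvwedgeNr); mvring.
Qed.

(* The value of [N, B]_RN on two arguments, for N of degree 0. *)
Definition twist D (B : V -> V -> V) P Q := B (D P) Q + B P (D Q) - D (B P Q).

Record even_der D : Prop := EvenDer {
  ed_der : derivation false D;
  ed_theta : forall c P, theta c (D P) = D (theta c P)
}.

Lemma ed_parity D : even_der D -> parity false D.
Proof. by move=> hD Q; rewrite -(ed_theta hD). Qed.

Lemma ed_par D p P : even_der D -> par p P -> par p (D P).
Proof.
move=> hD /par_eps hP; apply/par_eps.
by rewrite ed_theta // hP (lin_sg _ _ (der_lin (ed_der hD))).
Qed.

Lemma bider_twist k D B : even_der D -> bider k B -> bider k (twist D B).
Proof.
move=> hD hB; have [lD mD] := ed_der hD; rewrite /twist; split.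
- by move=> Q c P S; rewrite lD !(bd_linl hB) lD; mvring.
- by move=> P c Q S; rewrite lD !(bd_linr hB) lD; mvring.
- move=> p q P Q hP hQ; have hDP := ed_par hD hP; have hDQ := ed_par hD hQ.
  rewrite (bd_sym hB hDP hQ) (bd_sym hB hP hDQ) (bd_sym hB hP hQ) (lin_sg _ _ lD).
  by case: (_ && _) => /=; mvring.
- move=> c P Q c0; rewrite -!(ed_theta hD) -!(bd_theta hB) // (linZ lD).
  rewrite !(linD (theta_lin _)) (linN (theta_lin _)) (ed_theta hD) !scalerDr scalerN.
  by [].
- move=> p P Q S hP; have hDP := ed_par hD hP.
  rewrite mD (linD (bd_linr hB P)) !(bd_mul hB _ _ hP) !(bd_mul hB _ _ hDP) (linD lD) !mD /=.
  have -> T : D (tw (p (+) odd k) T) = tw (p (+) odd k) (D T).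
    by case: (_ (+) _) => //=; rewrite (ed_theta hD).
  by rewrite !(mvwedgeDl, mvwedgeDr, mvwedgeNl, mvwedgeNr); mvring.
Qed.

(** * The Richardson-Nijenhuis bracket of two binary forms *)

Section Bracket.
Variables (k : nat) (C B : V -> V -> V) (hC : bider 2 C) (hB : bider k B).

(* iota_K L on homogeneous arguments of parities p, q, r. *)
Definition insert3 (K L : V -> V -> V) p q r P Q S :=
  L (K P Q) S + sg (q && r) (L (K P S) Q) + sg (p && (q (+) r)) (L (K Q S) P).

(** The sign of the second term is always minus: C lowers the total degree by 2, which is degree 0
    after the shift by 2. *)
Definition bracket3 p q r P Q S :=
  insert3 C B p q r P Q S - insert3 B C p q r P Q S.

Lemma insert3_symr (K L : V -> V -> V) j p q r P Q S :
  (forall Q, linear (fun P => L P Q)) -> bider j K ->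
  par p P -> par q Q -> par r S ->
  insert3 K L p q r P Q S = sg (q && r) (insert3 K L p r q P S Q).
Proof.
move=> lL hK hP hQ hS; rewrite /insert3 (bd_sym hK hQ hS) (lin_sg _ _ (lL _)).
by case: p q r {hP hQ hS} => [] [] [] /=; mvring.
Qed.

Lemma insert3_syml (K L : V -> V -> V) j p q r P Q S :
  (forall Q, linear (fun P => L P Q)) -> bider j K ->
  par p P -> par q Q -> par r S ->
  insert3 K L p q r P Q S = sg (p && q) (insert3 K L q p r Q P S).
Proof.
move=> lL hK hP hQ hS; rewrite /insert3 (bd_sym hK hP hQ) (lin_sg _ _ (lL _)).
by case: p q r {hP hQ hS} => [] [] [] /=; mvring.
Qed.

(** With [bracket3_syml], this gives both adjacent transpositions, enough to bring any argument to
    the last place, where the bracket is a derivation. *)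
Lemma bracket3_symr p q r P Q S : par p P -> par q Q -> par r S ->
  bracket3 p q r P Q S = sg (q && r) (bracket3 p r q P S Q).
Proof.
move=> hP hQ hS; rewrite /bracket3.
rewrite (insert3_symr (bd_linl hB) hC hP hQ hS) (insert3_symr (bd_linl hC) hB hP hQ hS).
by case: (_ && _) => //=; rewrite opprB opprK addrC.
Qed.

Lemma bracket3_syml p q r P Q S : par p P -> par q Q -> par r S ->
  bracket3 p q r P Q S = sg (p && q) (bracket3 q p r Q P S).
Proof.
move=> hP hQ hS; rewrite /bracket3.
rewrite (insert3_syml (bd_linl hB) hC hP hQ hS) (insert3_syml (bd_linl hC) hB hP hQ hS).
by case: (_ && _) => //=; rewrite opprB opprK addrC.
Qed.

(* As an operator on the last argument, the bracket is a combination of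
   graded commutators of derivations. *)
Definition bracket_op p q P Q S :=
  B (C P Q) S - C (B P Q) S
  + ((B P (C Q S) - sg ((p (+) odd k) && q) (C Q (B P S)))
     + sg (p && q) (B Q (C P S) - sg ((q (+) odd k) && p) (C P (B Q S)))).

Lemma bracket_opE p q r P Q S : par p P -> par q Q -> par r S ->
  bracket3 p q r P Q S = bracket_op p q P Q S.
Proof.
move=> hP hQ hS; rewrite /bracket3 /insert3 /bracket_op.
rewrite (bd_sym hB (bd_par hC hP hS) hQ) (bd_sym hB (bd_par hC hQ hS) hP).
rewrite (bd_sym hC (bd_par hB hP hS) hQ) (bd_sym hC (bd_par hB hQ hS) hP).
by case: p q r (odd k) {hP hQ hS} => [] [] [] [] /=; mvring.
Qed.

Lemma bracket_op_der p q P Q : par p P -> par q Q ->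
  derivation (p (+) q (+) odd k) (bracket_op p q P Q).
Proof.
move=> hP hQ; have e1 : forall a b c : bool, a (+) b (+) c = a (+) b (+) false (+) c.
  by case; case; case.
apply: der_add; first apply: der_sub.
- by have := bd_der hB (bd_par hC hP hQ); rewrite /= addbF.
- by have := bd_der hC (bd_par hB hP hQ); rewrite /= addbF.
apply: der_add.
- have := der_comm (bd_der hB hP) (bd_der hC hQ) (bd_parity hB hP) (bd_parity hC hQ).
  by rewrite /= addbF addbAC.
- apply: der_sg.
  have := der_comm (bd_der hB hQ) (bd_der hC hP) (bd_parity hB hQ) (bd_parity hC hP).
  by rewrite /= addbF addbAC [q (+) p]addbC.
Qed.

Hypotheses (CfP : forall f P, C (fn f) P = 0)
  (Bff : forall f g, B (fn f) (fn g) = 0)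
  (BXf : forall X f, exists g, B (mvsect X) (fn f) = fn g)
  (CXX : forall X Y, exists g, C (mvsect X) (mvsect Y) = fn g)
  (BXX : forall X Y Z : sect A,
     bracket3 true true true (mvsect X) (mvsect Y) (mvsect Z) = 0).

Let CPf p P f : par p P -> C P (fn f) = 0.
Proof. by move=> hP; rewrite (bd_sym hC hP (par_fun f)) CfP sg0. Qed.

(** On generators with at least one function every term vanishes: C kills functions, B kills pairs
    of functions, and B(X, f) and C(X, Y) are functions. Three sections are covered by the
    hypothesis [BXX]. The arguments are then freed one by one, each from the last place. *)
Lemma bracket3_eq0 p q r P Q S : par p P -> par q Q -> par r S ->
  bracket3 p q r P Q S = 0.
Proof.
have B0l T : B 0 T = 0 by exact: (lin0 (bd_linl hB T)).
have C0l T : C 0 T = 0 by exact: (lin0 (bd_linl hC T)).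
have BfX X f : B (fn f) (mvsect X) = B (mvsect X) (fn f).
  by rewrite (bd_sym hB (par_fun f) (par_sect X)).
have fff f g h : bracket3 false false false (fn f) (fn g) (fn h) = 0.
  by rewrite /bracket3 /insert3 !CfP !Bff !B0l !C0l /= !addr0 subrr.
have Xff X f g : bracket3 true false false (mvsect X) (fn f) (fn g) = 0.
  have [u Hu] := BXf X f; have [v Hv] := BXf X g.
  rewrite /bracket3 /insert3 !(CPf _ (par_sect X)) Bff Hu Hv !CfP !B0l !C0l /=.
  by rewrite !addr0 subrr.
have XXf X Y f : bracket3 true true false (mvsect X) (mvsect Y) (fn f) = 0.
  have [u Hu] := BXf X f; have [v Hv] := BXf Y f; have [w Hw] := CXX X Y.
  rewrite /bracket3 /insert3 (CPf f (bd_par hB (par_sect X) (par_sect Y))).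
  by rewrite Hu Hv Hw !(CPf _ (par_sect _)) !CfP Bff !B0l /= !addr0 subrr.
have op0 p' q' T U : par p' T -> par q' U ->
    (forall f, bracket3 p' q' false T U (fn f) = 0) ->
    (forall X, bracket3 p' q' true T U (mvsect X) = 0) ->
    forall r' W, par r' W -> bracket3 p' q' r' T U W = 0.
  move=> hT hU h0 h1 r' W hW; rewrite (bracket_opE hT hU hW).
  apply: (der0 (bracket_op_der hT hU)) => [f|X].
    by rewrite -(bracket_opE hT hU (par_fun f)).
  by rewrite -(bracket_opE hT hU (par_sect X)).
have symr := bracket3_symr; have syml := bracket3_syml.
have ff f g : forall r' W, par r' W -> bracket3 false false r' (fn f) (fn g) W = 0.
  apply: op0 => [||//|X]; [exact: par_fun|exact: par_fun|].
  rewrite (symr _ _ _ _ _ _ (par_fun f) (par_fun g) (par_sect X)).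
  rewrite (syml _ _ _ _ _ _ (par_fun f) (par_sect X) (par_fun g)).
  by rewrite Xff !sg0.
have Xf X f : forall r' W, par r' W -> bracket3 true false r' (mvsect X) (fn f) W = 0.
  apply: op0 => [||//|Y]; [exact: par_sect|exact: par_fun|].
  rewrite (symr _ _ _ _ _ _ (par_sect X) (par_fun f) (par_sect Y)).
  by rewrite XXf sg0.
have XX X Y : forall r' W, par r' W -> bracket3 true true r' (mvsect X) (mvsect Y) W = 0.
  by apply: op0 => //; exact: par_sect.
have f_ f : forall q' U, par q' U -> forall r' W, par r' W ->
    bracket3 false q' r' (fn f) U W = 0.
  move=> q' U hU; apply: op0 => // [|g|X]; first exact: par_fun.
    by rewrite (symr _ _ _ _ _ _ (par_fun f) hU (par_fun g)) ff ?sg0.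
  rewrite (symr _ _ _ _ _ _ (par_fun f) hU (par_sect X)).
  by rewrite (syml _ _ _ _ _ _ (par_fun f) (par_sect X) hU) Xf ?sg0.
have X_ X : forall q' U, par q' U -> forall r' W, par r' W ->
    bracket3 true q' r' (mvsect X) U W = 0.
  move=> q' U hU; apply: op0 => // [|g|Y]; first exact: par_sect.
    by rewrite (symr _ _ _ _ _ _ (par_sect X) hU (par_fun g)) Xf ?sg0.
  by rewrite (symr _ _ _ _ _ _ (par_sect X) hU (par_sect Y)) XX ?sg0.
move=> hP hQ; move: r S; apply: (op0 _ _ _ _ hP hQ) => [f|X].
  rewrite (symr _ _ _ _ _ _ hP hQ (par_fun f)).
  by rewrite (syml _ _ _ _ _ _ hP (par_fun f) hQ) f_ ?sg0.
rewrite (symr _ _ _ _ _ _ hP hQ (par_sect X)).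
by rewrite (syml _ _ _ _ _ _ hP (par_sect X) hQ) X_ ?sg0.
Qed.

End Bracket.
End Derivations.

(** * Extensions of (1,1)-tensors and 2-forms *)

Section Extensions.
Context {R : realType} {M : manifold R} {A : vbundle M}.
Local Notation V := (mvect A).
Local Notation fn := (mvfun A).
Local Notation "P /\_ Q" := (mvwedge P Q) (at level 40, left associativity).
Local Notation eps := (theta (-1)).
Implicit Types (P Q S : V) (D : V -> V) (f g : smoothfun M) (X Y : sect A).

(** The extensions are known only on products of sections; each of their properties is reduced to
    that case by this lemma and proved there by induction on the number of factors. *)
Lemma tensor_eq (D1 D2 : V -> V) : linear D1 -> linear D2 ->
  (forall f P, D1 (fn f /\_ P) = fn f /\_ D1 P) ->
  (forall f P, D2 (fn f /\_ P) = fn f /\_ D2 P) ->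
  (forall s : seq (sect A), D1 (wedges s) = D2 (wedges s)) -> D1 =1 D2.
Proof.
move=> l1 l2 t1 t2 w P; apply/eqP; rewrite -subr_eq0; apply/eqP.
apply: (tensor_ext (D := fun P => D1 P - D2 P)) => [c Q S|f Q|s].
- by rewrite l1 l2; mvring.
- by rewrite t1 t2 mvwedgeDr mvwedgeNr.
- by rewrite w subrr.
Qed.

Lemma theta_tensor c f P : theta c (fn f /\_ P) = fn f /\_ theta c P.
Proof. by rewrite theta_wedge theta_fun. Qed.

Lemma tw_lin d : linear (@tw _ _ A d).
Proof. by case: d => c P Q //=; rewrite theta_lin. Qed.

Lemma tw_tensor d f P : tw d (fn f /\_ P) = fn f /\_ tw d P.
Proof. by case: d => //=; rewrite theta_tensor. Qed.

Lemma par_wedges (s : seq (sect A)) : par (odd (size s)) (wedges s).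
Proof.
elim: s => [|X s IH]; first exact: par_fun.
exact: (par_wedge (par_sect X) IH).
Qed.

Lemma par_wedge_tw w P Q : par w P -> P /\_ Q = tw w Q /\_ P.
Proof.
move=> hP; have [Q0 [Q1 [h0 h1 ->]]] := par_split Q.
rewrite (linD (tw_lin w)) mvwedgeDr mvwedgeDl.
rewrite (mvwedgeC hP h0) (mvwedgeC hP h1) (tw_par _ h0) (tw_par _ h1).
by case: w {hP}; rewrite /= ?mvwedgeNl.
Qed.

Lemma sect_wedge_tw X Q : mvsect X /\_ Q = eps Q /\_ mvsect X.
Proof. exact: (par_wedge_tw Q (par_sect X)). Qed.

Section DerivationExtension.
Variables (N : sect A -> sect A) (D : V -> V) (hD : is_der_ext N D).
Let lD := der_ext_linear hD.

Lemma der_ext_sect X : D (mvsect X) = mvsect (N X).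
Proof. by rewrite -wedges1 (der_ext_wedges hD) big_ord1 wedges1. Qed.

(** On a product the first summand of the defining formula is the one where N acts on X, and the
    others are X times the formula for S. This is the induction step towards the full Leibniz
    rule. *)
Lemma der_ext_sect_wedge X S :
  D (mvsect X /\_ S) = mvsect (N X) /\_ S + mvsect X /\_ D S.
Proof.
move: S; apply: tensor_eq => [c P Q|c P Q|f P|f P|s].
- by rewrite mvwedge_linr lD.
- by rewrite lD !mvwedge_linr; mvring.
- by rewrite mvfun_wedgeCA (der_ext_tensor hD).
- by rewrite (der_ext_tensor hD) !mvfun_wedgeCA mvwedgeDr.
- rewrite -[mvsect X /\_ wedges s]/(wedges (X :: s)) !(der_ext_wedges hD).
  by rewrite big_ord_recl /= (lin_sum (mvwedge_linr _)).
Qed.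

Lemma even_der_ext : even_der D.
Proof.
split; last first.
  move=> c P; move: P; apply: tensor_eq => [d P Q|d P Q|f P|f P|s].
  - by rewrite lD theta_lin.
  - by rewrite theta_lin lD.
  - by rewrite (der_ext_tensor hD) theta_tensor.
  - by rewrite theta_tensor (der_ext_tensor hD).
  elim: s => [|X s IH] /=.
    by rewrite theta_fun (der_ext_fun hD) (lin0 (theta_lin _)).
  rewrite -/(wedges s) der_ext_sect_wedge (linD (theta_lin _)) !theta_wedge !theta_sect IH.
  by rewrite !mvwedgeZl (linZ lD) der_ext_sect_wedge; mvring.
split=> [|Q S]; first exact: lD.
move: Q; apply: tensor_eq => [d P Q|d P Q|f P|f P|s] /=.
- by rewrite mvwedge_linl lD.
- by rewrite lD !mvwedge_linl; mvring.
- by rewrite -mvwedgeA (der_ext_tensor hD).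
- by rewrite (der_ext_tensor hD) -!mvwedgeA mvwedgeDr.
elim: s => [|X s IH] /=.
  by rewrite mvfun1_wedge (der_ext_fun hD) mvwedge0l add0r mvfun1_wedge.
rewrite -/(wedges s) -mvwedgeA !der_ext_sect_wedge IH.
by rewrite !(mvwedgeDl, mvwedgeDr) !mvwedgeA; mvring.
Qed.

End DerivationExtension.

Section FormExtension.
Variables (a : sect A -> sect A -> smoothfun M) (ha : two_form a).
Variables (B : V -> V -> V) (hB : is_form_ext a B).
Let lB := form_ext_linear hB.
Let lBl := form_ext_linearl hB.
Let tB := form_ext_tensor hB.
Let tBl := form_ext_tensorl hB.

Lemma omit0 (T : Type) (x : T) s : omit 0 (x :: s) = s.
Proof. by rewrite /omit /= drop0. Qed.

Lemma scale_signS (n : nat) P : (-1) ^+ n.+1 *: P = - ((-1) ^+ n *: P).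
Proof. by rewrite exprS mulN1r scaleNr. Qed.

(** B(X, -) is the contraction with the 1-form a(X, -): the sign (-1)^(1+0+j+1) is + for j = 0 and
    alternates with j. *)
Lemma form_ext_sect_wedge X Y S : B (mvsect X) (mvsect Y /\_ S) =
  fn (a X Y) /\_ S - mvsect Y /\_ B (mvsect X) S.
Proof.
move: S; apply: tensor_eq => [c P Q|c P Q|f P|f P|s].
- by rewrite mvwedge_linr lB.
- by rewrite lB !mvwedge_linr; mvring.
- by rewrite mvfun_wedgeCA tB.
- rewrite tB (mvfun_wedgeCA f (fn (a X Y))) (mvfun_wedgeCA f (mvsect Y)).
  by rewrite mvwedgeDr mvwedgeNr.
rewrite -[mvsect Y /\_ wedges s]/(wedges (Y :: s)) -(wedges1 X) !(form_ext_wedges hB).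
rewrite !big_ord1 big_ord_recl; congr (_ + _).
  by rewrite /= omit0 mvfun1_wedge expr2 mulrNN mulr1 scale1r.
rewrite (lin_sum (mvwedge_linr _)) -sumrN; apply: eq_bigr => j _.
rewrite /= !mvfun1_wedge mvwedgeZr mvfun_wedgeCA /bump /= add1n.
by rewrite -scale_signS !addn1 !add1n.
Qed.

Lemma form_ext_sect2 X Y : B (mvsect X) (mvsect Y) = fn (a X Y).
Proof.
rewrite -[mvsect Y]mvwedge_mvfun1 form_ext_sect_wedge (form_ext_fun hB).
by rewrite mvwedge0r subr0 mvwedge_mvfun1.
Qed.

(** A new first factor raises p by one. The terms contracting X keep the sign (-1)^p, whence
    [eps P]; in the others i grows by one as well and the two changes cancel. *)
Lemma form_ext_wedge_sect X P Q : B (mvsect X /\_ P) Q =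
  eps P /\_ B (mvsect X) Q + mvsect X /\_ B P Q.
Proof.
move: P; apply: tensor_eq => [c P S|c P S|f P|f P|s].
- by rewrite mvwedge_linr lBl.
- by rewrite theta_lin mvwedge_linl lBl mvwedge_linr; mvring.
- by rewrite mvfun_wedgeCA tBl.
- by rewrite theta_tensor tBl -mvwedgeA mvfun_wedgeCA mvwedgeDr.
move: Q; apply: tensor_eq => [c P S|c P S|f P|f P|t].
- by rewrite lB.
- by rewrite !lB !mvwedge_linr; mvring.
- by rewrite tB.
- by rewrite !tB !mvfun_wedgeCA mvwedgeDr.
rewrite -[mvsect X /\_ wedges s]/(wedges (X :: s)) -(wedges1 X) !(form_ext_wedges hB).
rewrite big_ord_recl big_ord1; congr (_ + _).
  rewrite theta_wedges (lin_sum (mvwedge_linr _)); apply: eq_bigr => j _.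
  rewrite /= !omit0 mvfun1_wedge mvwedgeZl mvwedgeZr scalerA mvfun_wedgeCA.
  by rewrite -exprD; congr (_ ^+ _ *: _); rewrite !addn0 !addn1 !addnS.
rewrite wedges1 (lin_sum (mvwedge_linr _)); apply: eq_bigr => i _.
rewrite (lin_sum (mvwedge_linr _)); apply: eq_bigr => j _ /=.
rewrite mvwedgeZr mvfun_wedgeCA !mvwedgeA /bump /= add1n.
by rewrite !addnS !addSn !scale_signS opprK.
Qed.

Lemma form_ext_sect_mul X Q S : B (mvsect X) (Q /\_ S) =
  B (mvsect X) Q /\_ S + eps Q /\_ B (mvsect X) S.
Proof.
move: Q; apply: tensor_eq => [c P Q|c P Q|f P|f P|s].
- by rewrite mvwedge_linl lB.
- by rewrite theta_lin lB !mvwedge_linl; mvring.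
- by rewrite -mvwedgeA tB.
- by rewrite theta_tensor tB -!mvwedgeA mvwedgeDr.
elim: s => [|Y s IH] /=.
  by rewrite mvfun1_wedge theta_fun mvfun1_wedge (form_ext_fun hB) mvwedge0l add0r.
rewrite -/(wedges s) -mvwedgeA !form_ext_sect_wedge IH theta_wedge theta_sect scaleN1r.
by rewrite !(mvwedgeDl, mvwedgeDr, mvwedgeNl, mvwedgeNr) !mvwedgeA; mvring.
Qed.

Lemma form_ext_mul p P Q S : par p P ->
  B P (Q /\_ S) = B P Q /\_ S + tw p Q /\_ B P S.
Proof.
(* Homogeneity is moved from the first argument to Q', so that the identity is tensorial in an
   arbitrary P' and can be tested on products. *)
have main : forall q Q' P', par q Q' ->
    B P' (Q' /\_ S) = B P' Q' /\_ S + Q' /\_ B (tw q P') S.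
  move=> q Q' P' hQ; move: P'; apply: tensor_eq => [c P1 P2|c P1 P2|f P1|f P1|s].
  - by rewrite lBl.
  - by rewrite tw_lin !lBl mvwedge_linl mvwedge_linr; mvring.
  - by rewrite tBl.
  - by rewrite tw_tensor !tBl mvfun_wedgeCA -!mvwedgeA mvwedgeDr.
  rewrite (tw_par q (par_wedges (s := s))) (lin_sg _ _ (lBl S)).
  have -> : Q' /\_ sg (odd (size s) && q) (B (wedges s) S) =
      tw (odd (size s)) Q' /\_ B (wedges s) S.
    by rewrite (tw_par _ hQ) andbC; case: (_ && _); rewrite /= ?(mvwedgeNl, mvwedgeNr).
  elim: s => [|X s IH] /=; first by rewrite !(form_ext_funl hB) mvwedge0l mvwedge0r addr0.
  rewrite -/(wedges s) !form_ext_wedge_sect IH form_ext_sect_mul.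
  have hs : par (odd (size s)) (eps (wedges s)).
    by rewrite (par_epsE (par_wedges (s := s))); apply: par_sg; exact: par_wedges.
  rewrite !(mvwedgeDl, mvwedgeDr) !mvwedgeA.
  rewrite (par_wedge_tw (eps Q') hs) (sect_wedge_tw X (tw _ Q')).
  have tw1 : tw (odd (size s)) (eps Q') = tw (~~ odd (size s)) Q'.
    by rewrite -[eps Q']/(tw true Q') tw_tw addbT.
  have -> : eps (tw (odd (size s)) Q') = tw (~~ odd (size s)) Q'.
    by rewrite -[eps _]/(tw true (tw _ Q')) tw_tw.
  by rewrite tw1; mvring.
move=> hP; have [Q0 [Q1 [h0 h1 ->]]] := par_split Q.
rewrite mvwedgeDl (linD (lB P)) (main _ _ _ h0) (main _ _ _ h1) (linD (lB P)) (linD (tw_lin p)).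
rewrite (tw_par p h0) (tw_par p h1) (tw_par false hP) (tw_par true hP) andbF andbT /=.
case: p hP => hP /=; rewrite ?(linN (lBl S)) !(mvwedgeDl, mvwedgeDr, mvwedgeNl, mvwedgeNr); mvring.
Qed.

Lemma form_ext_sect_theta c X Q :
  c *: theta c (B (mvsect X) Q) = B (mvsect X) (theta c Q).
Proof.
move: Q; apply: tensor_eq => [d P Q|d P Q|f P|f P|s].
- by rewrite lB theta_lin; mvring.
- by rewrite theta_lin lB.
- by rewrite tB theta_tensor mvwedgeZr.
- by rewrite theta_tensor tB.
elim: s => [|Y s IH] /=.
  by rewrite theta_fun !(form_ext_fun hB) (lin0 (theta_lin _)) scaler0.
rewrite -/(wedges s) form_ext_sect_wedge theta_wedge theta_sect mvwedgeZl.
rewrite (linZ (lB _)) form_ext_sect_wedge -IH (linD (theta_lin _)) (linN (theta_lin _)).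
by rewrite !theta_wedge theta_fun theta_sect mvwedgeZl mvwedgeZr.
Qed.

Lemma form_ext_theta c P Q :
  c ^+ 2 *: theta c (B P Q) = B (theta c P) (theta c Q).
Proof.
move: P; apply: tensor_eq => [d P S|d P S|f P|f P|s].
- by rewrite lBl theta_lin; mvring.
- by rewrite theta_lin lBl.
- by rewrite tBl theta_tensor mvwedgeZr.
- by rewrite theta_tensor tBl.
elim: s => [|Y s IH] /=.
  by rewrite theta_fun !(form_ext_funl hB) (lin0 (theta_lin _)) scaler0.
rewrite -/(wedges s) form_ext_wedge_sect theta_wedge theta_sect mvwedgeZl.
rewrite (linZ (lBl _)) form_ext_wedge_sect -IH -form_ext_sect_theta.
rewrite (linD (theta_lin _)) !theta_wedge theta_sect !theta_theta [c * -1]mulrC.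
by rewrite !(mvwedgeZl, mvwedgeZr); mvring.
Qed.

(** Sections are odd, so graded symmetry on two of them is the skew-symmetry of a, which enters in
    the induction step. *)
Lemma form_ext_sym_sect Y Q : B Q (mvsect Y) = B (mvsect Y) (eps Q).
Proof.
move: Q; apply: tensor_eq => [d P S|d P S|f P|f P|s].
- by rewrite lBl.
- by rewrite theta_lin lB.
- by rewrite tBl.
- by rewrite theta_tensor tB.
elim: s => [|Z s IH] /=; first by rewrite theta_fun (form_ext_fun hB) (form_ext_funl hB).
rewrite -/(wedges s) form_ext_wedge_sect theta_wedge theta_sect scaleN1r mvwedgeNl.
rewrite (linN (lB _)) form_ext_sect_wedge -IH form_ext_sect2 mvfun_wedgeC.
by rewrite (two_form_skew ha Z Y) mvfunN mvwedgeNl opprB addrC.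
Qed.

Lemma form_ext_sym p q P Q : par p P -> par q Q -> B P Q = sg (p && q) (B Q P).
Proof.
have par_sectB Y q' Q' : par q' Q' -> par (~~ q') (B (mvsect Y) Q').
  move=> /par_eps hQ; apply/par_eps.
  have := form_ext_sect_theta (-1) Y Q'; rewrite hQ (lin_sg _ _ (lB _)) scaleN1r.
  by case: q' {hQ} => /= /(congr1 -%R); rewrite !opprK.
(* [tw p] carries the sign for an arbitrary P', which makes the identity tensorial in P'. *)
move=> hP hQ; suff main P' : B P P' = B (tw p P') P.
  by rewrite main (tw_par p hQ) (lin_sg _ _ (lBl _)) andbC.
move: P'; apply: tensor_eq => [d P1 P2|d P1 P2|f P'|f P'|s].
- by rewrite lB.
- by rewrite tw_lin lBl.
- by rewrite tB.
- by rewrite tw_tensor tBl.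
elim: s => [|Y s IH] /=; first by rewrite tw_fun (form_ext_fun hB) (form_ext_funl hB).
rewrite -/(wedges s) (form_ext_mul _ _ hP) IH form_ext_sym_sect (par_epsE hP).
have hYs := par_wedge (par_sect Y) (par_wedges (s := s)).
rewrite !(tw_par p (par_wedges (s := s))) (tw_par p (par_sect Y)) (tw_par p hYs).
rewrite (lin_sg _ _ (lB _)) !(lin_sg _ _ (lBl _)) form_ext_wedge_sect.
have -> : eps (wedges s) /\_ B (mvsect Y) P =
    sg (odd (size s) && p) (B (mvsect Y) P /\_ wedges s).
  rewrite (par_epsE (par_wedges (s := s))).
  rewrite (mvwedgeC (par_sectB Y _ _ hP) (par_wedges (s := s))).
  by case: p (odd _) {IH hP hYs} => [] [] //=; rewrite ?(mvwedgeNl, opprK).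
by case: p (odd _) {IH hP hYs} => [] [] /=; rewrite ?(mvwedgeNl, mvwedgeNr); mvring.
Qed.

Lemma bider_form_ext : bider 2 B.
Proof.
split=> [Q|P|p q P Q|c P Q _|p P Q S hP].
- exact: lBl.
- exact: lB.
- exact: form_ext_sym.
- exact: form_ext_theta.
- by rewrite addbF; exact: form_ext_mul.
Qed.

End FormExtension.
End Extensions.

(** * The Schouten-Nijenhuis bracket *)

Section Schouten.
Context {R : realType} {M : manifold R} {A : vbundle M}.
Local Notation V := (mvect A).
Local Notation fn := (mvfun A).
Local Notation "P /\_ Q" := (mvwedge P Q) (at level 40, left associativity).
Local Notation eps := (theta (-1)).
Implicit Types (P Q S : V) (D : V -> V) (f g : smoothfun M) (X Y : sect A).

Lemma signz_scale (z : int) P : (-1 : R) ^ z *: P = sg (odd (absz z)) P.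
Proof.
case: z => n; first exact: scale_sign.
by rewrite NegzE -exprnN invr_sign scale_sign abszN.
Qed.

Lemma odd_absz_pred (n : nat) : odd (absz (n%:Z - 1)) = ~~ odd n.
Proof. by case: n => [|n] //; rewrite intS addrC addKr absz_nat /= negbK. Qed.

Lemma par_component b P (k : nat) : par b P -> odd k != b -> component (k%:Z - 2) P = 0.
Proof.
move=> hP ne; apply: mv_eq => x s; rewrite /= /component_val.
rewrite (inj_eq (addIr _)) eqz_nat; case: eqP => // sk.
by apply: hP; rewrite sk.
Qed.

Lemma par_ind b D P : linear D ->
  (forall k Q, multivector k Q -> odd k = b -> D Q = 0) -> par b P -> D P = 0.
Proof.
move=> lD h hP; rewrite (mv_components P) (lin_sum lD) big1 // => k _.
have [ok|ne] := eqVneq (odd k) b; last by rewrite (par_component hP ne) (lin0 lD).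
by apply: h ok; exact: component_multivector.
Qed.

Lemma multivector_ind D P : linear D ->
  (forall k Q, multivector k Q -> D Q = 0) -> D P = 0.
Proof.
move=> lD h; rewrite (mv_components P) (lin_sum lD) big1 // => k _.
by apply: h; exact: component_multivector.
Qed.

Lemma multivector_eps k P : multivector k P -> eps P = sg (odd k) P.
Proof. by move=> /par_multivector/par_epsE. Qed.

Variables (L : lie_algebroid A) (B : V -> V -> V) (hB : is_schouten L B).
Let lB := schouten_linear hB.
Let lBl := schouten_linearl hB.

Lemma schouten_skewE p q P Q : multivector p P -> multivector q Q ->
  B P Q = - sg (~~ odd p && ~~ odd q) (B Q P).
Proof.
move=> hP hQ; rewrite (schouten_skew hB hP hQ) scaleNr signz_scale abszM oddM.
by rewrite !odd_absz_pred.
Qed.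

Lemma schouten_der p P : multivector p P -> derivation (~~ odd p) (B P).
Proof.
move=> hP; split=> [|Q S]; first exact: lB.
apply/eqP; rewrite -subr_eq0; apply/eqP.
apply: (multivector_ind (D := fun Q => B P (Q /\_ S) -
  (B P Q /\_ S + tw (~~ odd p) Q /\_ B P S))) => [c Q1 Q2|q Q' hQ].
  rewrite mvwedge_linl !lB (tw_lin _ c Q1 Q2) !mvwedge_linl; mvring.
rewrite (schouten_leibniz hB S hP hQ) signz_scale abszM oddM odd_absz_pred absz_nat.
rewrite (tw_par _ (par_multivector hQ)) andbC.
by case: (_ && _); rewrite /= ?mvwedgeNl subrr.
Qed.

Lemma multivector_fun f : multivector 0 (fn f).
Proof. by apply/multivectorP => x []. Qed.

Lemma multivector_sect X : multivector 1 (mvsect X).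
Proof. by apply/multivectorP => x [|y [|z s]]. Qed.

(** That the bracket lowers the total degree by 1 is derived from its rules: the conjugate of B(P,
    -) by [theta c] and the expected multiple of B(P, -) are derivations, compared on functions and
    sections. *)
Lemma schouten_theta_gen (c : R) p P : c != 0 -> multivector p P ->
  (forall f, c *: theta c (B P (fn f)) = c ^+ p *: B P (fn f)) ->
  (forall X, c *: theta c (B P (mvsect X)) = c ^+ p.+1 *: B P (mvsect X)) ->
  forall Q, c *: theta c (B P Q) = c ^+ p *: B P (theta c Q).
Proof.
move=> c0 hP hf hX Q; have dB := schouten_der hP.
have cancelc S T : c *: theta c S = T -> c *: S = theta c^-1 T.
  by move=> <-; rewrite (linZ (theta_lin _)) theta_theta mulVf // theta1.
have key : c ^+ p *: theta c^-1 (B P (theta c Q)) + (- c) *: B P Q = 0.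
  apply: (der0 (der_linear_comb _ (der_conj c0 dB) (der_scale (- c) dB))) => [f|X].
    rewrite theta_fun scaleNr (cancelc _ _ (hf f)) (linZ (theta_lin _)).
    by rewrite subrr.
  rewrite theta_sect (linZ (lB P)) (linZ (theta_lin _)) scaleNr (cancelc _ _ (hX X)).
  by rewrite (linZ (theta_lin _)) scalerA -exprSr subrr.
move/eqP: key; rewrite scaleNr subr_eq0 => /eqP/(congr1 (theta c)).
by rewrite !(linZ (theta_lin _)) theta_theta mulfV // theta1 => <-.
Qed.

Lemma schouten_fun_sect f X : B (fn f) (mvsect X) = - fn (rho L X f).
Proof.
rewrite (schouten_skewE (multivector_fun f) (multivector_sect X)) /=.
by rewrite (schouten_sect_fun hB).
Qed.

(** The comparison is made for P a function, then a section; by skew-symmetry these two cases supply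
    the values on functions and sections that a general P requires. *)
Lemma schouten_theta (c : R) p P Q : c != 0 -> multivector p P ->
  c *: theta c (B P Q) = c ^+ p *: B P (theta c Q).
Proof.
move=> c0.
have hf f S : c *: theta c (B (fn f) S) = B (fn f) (theta c S).
  rewrite (schouten_theta_gen c0 (multivector_fun f)) ?scale1r // => [g|X].
    by rewrite (schouten_fun hB) (lin0 (theta_lin _)) !scaler0.
  by rewrite schouten_fun_sect (linN (theta_lin _)) theta_fun.
have hX X S : c *: theta c (B (mvsect X) S) = c *: B (mvsect X) (theta c S).
  rewrite (schouten_theta_gen c0 (multivector_sect X)) ?scale1r // => [g|Y].
    by rewrite (schouten_sect_fun hB) theta_fun.
  by rewrite (schouten_sect hB) theta_sect scalerA.
move=> hP; apply: schouten_theta_gen => // [f|X].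
  rewrite (schouten_skewE hP (multivector_fun f)) (linN (theta_lin _)).
  rewrite (lin_sg _ _ (theta_lin c)) scalerN.
  have -> b S : c *: sg b S = sg b (c *: S) by case: b; rewrite /= ?scalerN.
  rewrite hf (theta_multivector _ hP) (linZ (lB _)).
  by case: (_ && _); rewrite /= ?scalerN.
rewrite (schouten_skewE hP (multivector_sect X)) (linN (theta_lin _)).
rewrite (lin_sg _ _ (theta_lin c)) scalerN.
have -> b S : c *: sg b S = sg b (c *: S) by case: b; rewrite /= ?scalerN.
rewrite hX (theta_multivector _ hP) (linZ (lB _)) scalerA -exprS.
by case: (_ && _); rewrite /= ?scalerN.
Qed.

(** The factor (-1)^(p-1) is minus the parity involution, so the decomposition into components
    disappears. *)
Lemma l2E P Q : l2 B P Q = - B (eps P) Q.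
Proof.
rewrite /l2 [in RHS](mv_components P) (lin_sum (theta_lin _)) (lin_sum (lBl Q)) -sumrN.
apply: eq_bigr => k _; rewrite signz_scale odd_absz_pred.
rewrite (multivector_eps (@component_multivector _ _ _ k P)) (lin_sg _ _ (lBl Q)).
by case: (odd k); rewrite /= ?opprK.
Qed.

Lemma l2_sect X Y : l2 B (mvsect X) (mvsect Y) = mvsect (lbracket L X Y).
Proof.
by rewrite l2E theta_sect scaleN1r (linN (lBl _)) opprK (schouten_sect hB).
Qed.

Lemma l2_sect_fun X f : l2 B (mvsect X) (fn f) = fn (rho L X f).
Proof.
by rewrite l2E theta_sect scaleN1r (linN (lBl _)) opprK (schouten_sect_fun hB).
Qed.

Lemma l2_fun f g : l2 B (fn f) (fn g) = 0.
Proof. by rewrite l2E theta_fun (schouten_fun hB) oppr0. Qed.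

(** Graded symmetry comes from -(-1)^(p-1) (-1)^((p-1)(q-1)) = (-1)^(pq) (-1)^(q-1). Each identity
    is linear in the argument on which its sign depends, hence checked on homogeneous components. *)
Lemma bider_l2 : bider 1 (l2 B).
Proof.
have -> : l2 B = fun P Q => - B (eps P) Q by apply/funext => P; apply/funext => Q; exact: l2E.
split=> [Q c P S|P c Q S|p q P Q hP hQ|c P Q c0|p P Q S hP].
- by rewrite theta_lin lBl; mvring.
- by rewrite lB; mvring.
- rewrite (par_epsE hP) (par_epsE hQ) (lin_sg _ _ (lBl _)) (lin_sg _ _ (lBl _)).
  apply/eqP; rewrite -subr_eq0; apply/eqP.
  apply: (par_ind (D := fun P => - sg p (B P Q) - sg (p && q) (- sg q (B Q P))) _ _ hP).
    by move=> d P1 P2; case: (p) (q) => [] [] /=; rewrite lB lBl; mvring.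
  move=> k P' hP' pk.
  apply: (par_ind (D := fun Q => - sg p (B P' Q) - sg (p && q) (- sg q (B Q P'))) _ _ hQ).
    by move=> d P1 P2; case: (p) (q) => [] [] /=; rewrite lB lBl; mvring.
  move=> l Q' hQ' ql; rewrite (schouten_skewE hP' hQ') pk ql.
  by case: (p) (q) => [] [] /=; mvring.
- rewrite expr1; apply/eqP; rewrite -subr_eq0; apply/eqP.
  apply: (multivector_ind (D := fun P =>
    c *: theta c (- B (eps P) Q) - - B (eps (theta c P)) (theta c Q))).
    by move=> d P1 P2; rewrite !theta_lin !lBl !(linN (theta_lin _)) theta_lin; mvring.
  move=> k P' hP'; rewrite (linN (theta_lin _)) scalerN.
  rewrite (theta_multivector c hP') (linZ (theta_lin _)) (multivector_eps hP').
  rewrite !(lin_sg _ _ (lBl _)) (linZ (lBl _)) (lin_sg _ _ (lBl _)) (lin_sg _ _ (theta_lin c)).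
  have h := schouten_theta Q c0 hP'.
  by case: (odd k); rewrite /= ?scalerN h; mvring.
- apply/eqP; rewrite -subr_eq0; apply/eqP.
  apply: (par_ind (D := fun P => - B (eps P) (Q /\_ S) -
    ((- B (eps P) Q) /\_ S + tw (p (+) odd 1) Q /\_ (- B (eps P) S))) _ _ hP).
    move=> d P1 P2; rewrite !theta_lin !lBl.
    by rewrite !(mvwedgeNl, mvwedgeNr, mvwedge_linl, mvwedge_linr); mvring.
  move=> k P' hP' <-; rewrite (multivector_eps hP') !(lin_sg _ _ (lBl _)).
  rewrite (der_mul (schouten_der hP')) addbT.
  by case: (odd k) => /=; rewrite !(mvwedgeNl, mvwedgeNr); mvring.
Qed.

End Schouten.

(** * Vector valued forms *)

Section VectorValuedForms.
Context {R : realType} {M : manifold R} {A : vbundle M}.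
Local Notation V := (mvect A).
Local Notation vform := (seq V -> V).
Local Notation I := 'I_(rank A).+1.
Implicit Types (P Q S : V) (K L : vform) (f : V -> V) (g : V -> V -> V).

Lemma sum_tupleS (T : finType) (W : zmodType) n (F : seq T -> W) :
  \sum_(t : n.+1.-tuple T) F t = \sum_x \sum_(t : n.-tuple T) F (x :: t).
Proof.
rewrite pair_big /= (reindex (fun p : T * n.-tuple T => cons_tuple p.1 p.2)) //=.
exists (fun t : n.+1.-tuple T => (thead t, behead_tuple t)) => [[x t] _|t _] /=.
  by rewrite theadE; congr (_, _); apply: val_inj.
by case/tupleP: t => x t; apply: val_inj; rewrite /= theadE.
Qed.

Lemma sum_tuple0 (T : finType) (W : zmodType) (F : seq T -> W) :
  \sum_(t : 0.-tuple T) F t = F [::].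
Proof. by rewrite (big_pred1 [tuple]) // => t; apply/esym/eqP; exact: tuple0. Qed.

(* The summand of [insertion] of degrees ds - 2. *)
Definition insertion_at K L (s : seq V) (ds : seq I) :=
  \sum_(m <- masks (size s))
    let degs := [seq (val d)%:Z - 2 | d : I <- ds] in
    let s' := [seq component zP.1 zP.2 | zP <- zip degs s] in
    (-1 : R) ^+ koszul m degs *: L (K (mask m s') :: mask (map negb m) s').

Lemma insertionE K L s :
  insertion K L s = \sum_(ds : (size s).-tuple I) insertion_at K L s ds.
Proof. by []. Qed.

Lemma insertion_1 K L P :
  insertion K L [:: P] = \sum_(i : I) insertion_at K L [:: P] [:: i].
Proof.
rewrite insertionE sum_tupleS; apply: eq_bigr => i _.
exact: (sum_tuple0 (fun t => insertion_at K L _ (i :: t))).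
Qed.

Lemma insertion_2 K L P Q : insertion K L [:: P; Q] =
  \sum_(i : I) \sum_(j : I) insertion_at K L [:: P; Q] [:: i; j].
Proof.
rewrite insertionE sum_tupleS; apply: eq_bigr => i _.
rewrite (sum_tupleS _ (fun t => insertion_at K L _ (i :: t))); apply: eq_bigr => j _.
exact: (sum_tuple0 (fun t => insertion_at K L _ (i :: j :: t))).
Qed.

Lemma insertion_3 K L P Q S : insertion K L [:: P; Q; S] =
  \sum_(i : I) \sum_(j : I) \sum_(l : I) insertion_at K L [:: P; Q; S] [:: i; j; l].
Proof.
rewrite insertionE sum_tupleS; apply: eq_bigr => i _.
rewrite (sum_tupleS _ (fun t => insertion_at K L _ (i :: t))); apply: eq_bigr => j _.
rewrite (sum_tupleS _ (fun t => insertion_at K L _ (i :: j :: t))); apply: eq_bigr => l _.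
exact: (sum_tuple0 (fun t => insertion_at K L _ (i :: j :: l :: t))).
Qed.

(** An unshuffle of the wrong type makes K return its default value 0, which L must send to 0 when
    it stands first. *)
Lemma insertion_size0 (k l : nat) K L s :
  (forall u, size u != k -> K u = 0) -> (forall u, size u != l -> L u = 0) ->
  (forall u, L (0 :: u) = 0) -> (size s).+1 != (k + l)%N -> insertion K L s = 0.
Proof.
move=> hK hL L0 ne; rewrite /insertion big1 // => ds _.
rewrite big1_seq // => m /andP[_ /size_masks sm] /=.
set s' := map _ (zip _ _); have ss' : size s' = size s.
  by rewrite size_map size_zip size_map size_tuple minnn.
have [km|nk] := eqVneq (size (mask m s')) k; last by rewrite hK // L0 scaler0.
rewrite hL ?scaler0 //=; apply: contra ne => /eqP <-.
by rewrite -km addnS -(size_mask_negb (s := s')) ?ss'.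
Qed.

(** The shift by 2 preserves parity, so Koszul signs can be read off exterior degrees. *)
Lemma odd_absz_sub2 (n : nat) : odd (absz (n%:Z - 2)) = odd n.
Proof. lia. Qed.

Lemma odd_abszD (a b : int) : odd (absz (a + b)) = odd (absz a) (+) odd (absz b).
Proof. lia. Qed.

Lemma component_par (k : nat) P : par (odd k) (component (k%:Z - 2) P).
Proof. by apply/par_multivector/component_multivector. Qed.

Lemma vform2_size g u : size u != 2 -> vform2 g u = 0.
Proof. by case: u => [|? [|? [|? ?]]]. Qed.

Lemma vform1_size f u : size u != 1 -> vform1 f u = 0.
Proof. by case: u => [|? [|? ?]]. Qed.

Lemma vform2_0 g u : (forall Q, linear (fun P => g P Q)) -> vform2 g (0 :: u) = 0.
Proof. by move=> lg; case: u => [|Q [|? ?]] //=; rewrite (lin0 (lg Q)). Qed.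

Lemma vform1_0 f u : linear f -> vform1 f (0 :: u) = 0.
Proof. by move=> lf; case: u => [|? ?] //=; rewrite (lin0 lf). Qed.

Lemma bilin_sum g (lgl : forall Q, linear (fun P => g P Q))
    (lgr : forall P, linear (g P)) P Q :
  \sum_(i : I) \sum_(j : I) g (component (i%:Z - 2) P) (component (j%:Z - 2) Q) = g P Q.
Proof.
rewrite [in RHS](mv_components P) (lin_sum (lgl Q)); apply: eq_bigr => i _.
by rewrite [in RHS](mv_components Q) (lin_sum (lgr _)).
Qed.

Lemma insertion11 f1 f2 : linear f1 -> linear f2 ->
  insertion (vform1 f1) (vform1 f2) = vform1 (f2 \o f1).
Proof.
move=> l1 l2; apply/funext => s; have [s1|ne] := eqVneq (size s) 1; last first.
  rewrite (insertion_size0 (@vform1_size _) (@vform1_size _) (fun u => vform1_0 u l2)) //.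
  by rewrite vform1_size.
case: s s1 => [|P [|? ?]] // _; rewrite insertion_1 /=.
rewrite [in RHS](mv_components P) (lin_sum l1) (lin_sum l2); apply: eq_bigr => i _.
rewrite /insertion_at /= !(big_cons, big_nil) /=.
by rewrite scaler0 !addr0 scale1r.
Qed.

Lemma insertion21 f g : linear f ->
  (forall Q, linear (fun P => g P Q)) -> (forall P, linear (g P)) ->
  insertion (vform2 g) (vform1 f) = vform2 (fun P Q => f (g P Q)).
Proof.
move=> lf lgl lgr; apply/funext => s; have [s2|ne] := eqVneq (size s) 2; last first.
  rewrite (insertion_size0 (@vform2_size _) (@vform1_size _) (fun u => vform1_0 u lf)) //.
  by rewrite vform2_size.
case: s s2 => [|P [|Q [|? ?]]] // _; rewrite insertion_2 /=.
rewrite -(bilin_sum (g := fun P Q => f (g P Q))); last first.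
- by move=> P' c Q1 Q2; rewrite lgr lf.
- by move=> Q' c P1 P2; rewrite lgl lf.
apply: eq_bigr => i _; apply: eq_bigr => j _.
rewrite /insertion_at /= !big_cons big_nil /=.
by rewrite ?scaler0 !addr0 scale1r.
Qed.

(** The unshuffle selecting Q yields g(f Q, P) with the sign of exchanging P and Q; since f
    preserves parity, graded symmetry of g absorbs it. *)
Lemma insertion12 k f g : even_der f -> bider k g ->
  insertion (vform1 f) (vform2 g) = vform2 (fun P Q => g (f P) Q + g P (f Q)).
Proof.
move=> hf hg; have lf := der_lin (ed_der hf).
have lgl := bd_linl hg; have lgr := bd_linr hg.
apply/funext => s; have [s2|ne] := eqVneq (size s) 2; last first.
  rewrite (insertion_size0 (@vform1_size _) (@vform2_size _) (fun u => vform2_0 u lgl)) //.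
  by rewrite vform2_size.
case: s s2 => [|P [|Q [|? ?]]] // _; rewrite insertion_2 /=.
rewrite -(bilin_sum (g := fun P Q => g (f P) Q + g P (f Q))); last first.
- by move=> P' c Q1 Q2; rewrite !lgr lf lgr; mvring.
- by move=> Q' c P1 P2; rewrite !lgl lf lgl; mvring.
apply: eq_bigr => i _; apply: eq_bigr => j _.
rewrite /insertion_at /= !(big_cons, big_nil) /= !(big_cons, big_nil).
rewrite !scaler0 !addr0 add0r mulr0 scale1r; congr (_ + _).
have hP := @component_par i P; have hQ := @component_par j Q.
rewrite (bd_sym hg (ed_par hf hQ) hP) abszM oddM !odd_absz_sub2 andbC.
by rewrite scale_sign oddb; case: (_ && _); rewrite /= ?opprK.
Qed.

Lemma RN0E (l : int) K L s : RN 0 l K L s = insertion K L s - insertion L K s.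
Proof. by rewrite /RN mul0r expr0z scale1r. Qed.

Lemma RN11 (l : int) f1 f2 : linear f1 -> linear f2 ->
  (forall P, f1 (f2 P) = f2 (f1 P)) -> RN 0 l (vform1 f1) (vform1 f2) = fun=> 0.
Proof.
move=> l1 l2 c; apply/funext => s; rewrite RN0E !insertion11 //.
by case: s => [|P [|? ?]] //=; rewrite ?c subrr.
Qed.

Lemma RN12 (l : int) k f g : even_der f -> bider k g ->
  RN 0 l (vform1 f) (vform2 g) = vform2 (twist f g).
Proof.
move=> hf hg; apply/funext => s; rewrite RN0E (insertion12 hf hg) insertion21.
- by case: s => [|P [|Q [|? ?]]] //=; rewrite subrr.
- exact: der_lin (ed_der hf).
- exact: bd_linl hg.
- exact: bd_linr hg.
Qed.

Lemma insertion22 g1 g2 P Q S :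
  (forall Q, linear (fun P => g2 P Q)) ->
  insertion (vform2 g1) (vform2 g2) [:: P; Q; S] =
  \sum_(i : I) \sum_(j : I) \sum_(l : I) insert3 g1 g2 (odd i) (odd j) (odd l)
    (component (i%:Z - 2) P) (component (j%:Z - 2) Q) (component (l%:Z - 2) S).
Proof.
move=> lg; rewrite insertion_3; apply: eq_bigr => i _.
apply: eq_bigr => j _; apply: eq_bigr => l _.
rewrite /insertion_at /insert3 /= !(big_cons, big_nil) /= !(big_cons, big_nil).
rewrite !scaler0 !(addr0, add0r) !mulr0 /= !abszM !oddM !addbF !odd_absz_sub2.
by rewrite odd_abszD !odd_absz_sub2 !scale_sign !oddb addrA.
Qed.

Lemma RN22 (l : int) k g1 g2 : bider 2 g1 -> bider k g2 ->
  (forall p q r P Q S, par p P -> par q Q -> par r S ->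
     bracket3 g1 g2 p q r P Q S = 0) ->
  RN 0 l (vform2 g1) (vform2 g2) = fun=> 0.
Proof.
move=> h1 h2 b0; have l1 := bd_linl h1; have l2 := bd_linl h2.
apply/funext => s; rewrite RN0E; have [s3|ne] := eqVneq (size s) 3; last first.
  rewrite (insertion_size0 (@vform2_size _) (@vform2_size _) (fun u => vform2_0 u l2)) //.
  rewrite (insertion_size0 (@vform2_size _) (@vform2_size _) (fun u => vform2_0 u l1)) //.
  by rewrite subrr.
case: s s3 => [|P [|Q [|S [|? ?]]]] // _; rewrite !insertion22 // -sumrB big1 // => i _.
rewrite -sumrB big1 // => j _; rewrite -sumrB big1 // => m _.
by apply: b0; exact: component_par.
Qed.

Lemma insertion_addr K L1 L2 s :
  insertion K (vform_add L1 L2) s = insertion K L1 s + insertion K L2 s.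
Proof.
rewrite /insertion -big_split; apply: eq_bigr => ds _ /=.
by rewrite -big_split; apply: eq_bigr => m _ /=; rewrite scalerDr.
Qed.

Lemma insertion_addl K1 K2 L s :
  (forall P Q u, L (P + Q :: u) = L (P :: u) + L (Q :: u)) ->
  insertion (vform_add K1 K2) L s = insertion K1 L s + insertion K2 L s.
Proof.
move=> lL; rewrite /insertion -big_split; apply: eq_bigr => ds _ /=.
by rewrite -big_split; apply: eq_bigr => m _ /=; rewrite lL scalerDr.
Qed.

Lemma RN_addl (l : int) K1 K2 L :
  (forall P Q u, L (P + Q :: u) = L (P :: u) + L (Q :: u)) ->
  RN 0 l (vform_add K1 K2) L = vform_add (RN 0 l K1 L) (RN 0 l K2 L).
Proof.
move=> lL; apply/funext => s.
by rewrite /vform_add !RN0E insertion_addl // insertion_addr opprD addrACA.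
Qed.

Lemma RN_addr (l : int) K L1 L2 :
  (forall P Q u, K (P + Q :: u) = K (P :: u) + K (Q :: u)) ->
  RN 0 l K (vform_add L1 L2) = vform_add (RN 0 l K L1) (RN 0 l K L2).
Proof.
move=> lK; apply/funext => s.
by rewrite /vform_add !RN0E insertion_addl // insertion_addr opprD addrACA.
Qed.

Lemma vform1D f P Q u : linear f ->
  vform1 f (P + Q :: u) = vform1 f (P :: u) + vform1 f (Q :: u).
Proof. by move=> lf; case: u => [|? ?] /=; rewrite ?(linD lf) ?addr0. Qed.

Lemma vform2D g P Q u : (forall Q, linear (fun P => g P Q)) ->
  vform2 g (P + Q :: u) = vform2 g (P :: u) + vform2 g (Q :: u).
Proof. by move=> lg; case: u => [|S [|? ?]] /=; rewrite ?(linD (lg _)) ?addr0. Qed.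

Lemma vform_addD K1 K2 :
  (forall P Q u, K1 (P + Q :: u) = K1 (P :: u) + K1 (Q :: u)) ->
  (forall P Q u, K2 (P + Q :: u) = K2 (P :: u) + K2 (Q :: u)) ->
  forall P Q u, vform_add K1 K2 (P + Q :: u) =
    vform_add K1 K2 (P :: u) + vform_add K1 K2 (Q :: u).
Proof. by move=> h1 h2 P Q u; rewrite /vform_add h1 h2 addrACA. Qed.

Lemma has_degree_cases z P :
  has_degree z P -> P = 0 \/ exists2 p : nat, z = p%:Z - 2 & multivector p P.
Proof.
move=> hP; have E : z = z + 2 - 2 by rewrite addrK.
case zE : (z + 2) => [p|p]; rewrite zE in E.
  by right; exists p => //; rewrite /multivector -E.
by left; apply: mv_eq => x s; rewrite hP // E (inj_eq (addIr _)).
Qed.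

Lemma has_degree_par z P : has_degree z P -> par (odd (absz z)) P.
Proof.
case/has_degree_cases => [->|[p -> /par_multivector]]; first by move=> x s.
by rewrite odd_absz_sub2.
Qed.

Lemma bider_degree k g x y P Q : bider k g -> has_degree x P -> has_degree y Q ->
  has_degree (x + y + (2 - k%:Z)) (g P Q).
Proof.
move=> hg /has_degree_cases[->|[p -> hP]].
  by rewrite (lin0 (bd_linl hg Q)).
case/has_degree_cases => [->|[q -> hQ]]; first by rewrite (lin0 (bd_linr hg P)).
(* Scaling by 2 compares 2^(k + size s) with 2^(p + q), and the exponents differ when s has the
   wrong length. *)
move=> u s ne; have two0 : 2 != 0 :> R by rewrite pnatr_eq0.
have := bd_theta hg P Q two0.
rewrite (theta_multivector _ hP) (theta_multivector _ hQ).
rewrite (linZ (bd_linl hg _)) (linZ (bd_linr hg _)) scalerA -exprD.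
move/(congr1 (fun S : V => S u s)); rewrite !mvZE thetaE mulrA -exprD => /eqP.
rewrite -subr_eq0 -mulrBl mulf_eq0 => /orP[|/eqP//].
rewrite subr_eq0 -!natrX eqr_nat eqn_exp2l // => /eqP E.
by case/eqP: ne; lia.
Qed.

Lemma graded_vform2 k g (e : int) : bider k g -> e = 2 - k%:Z ->
  graded_vform e (vform2 g).
Proof.
move=> hg ->; have lgl := bd_linl hg; have lgr := bd_linr hg; split.
- case=> [|S1 [|S2 s]] t c P Q /=.
  + by case: t => [|T [|? ?]] /=; rewrite ?lgl ?scaler0 ?addr0.
  + by case: t => [|? ?] /=; rewrite ?lgr ?scaler0 ?addr0.
  + by case: s => [|? ?] /=; rewrite scaler0 addr0.
- case=> [|S1 [|S2 s]] t x y P Q hP hQ /=; last by case: s => [|? ?] /=; rewrite scaler0.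
    case: t => [|? ?] /=; last by rewrite scaler0.
    rewrite (bd_sym hg (has_degree_par hP) (has_degree_par hQ)).
    by rewrite signz_scale abszM oddM.
  by case: t => [|? ?] /=; rewrite scaler0.
- move=> ds [|P [|Q [|? ?]]] //; case: ds => [|x [|y [|? ?]]] //= _ hd.
  rewrite !big_cons big_nil addr0.
  by apply: bider_degree => //; [exact: (hd 0%N)|exact: (hd 1%N)].
Qed.

Lemma even_der_degree f x P : even_der f -> has_degree x P -> has_degree x (f P).
Proof.
move=> hf /has_degree_cases[->|[p -> hP]].
  by rewrite (lin0 (der_lin (ed_der hf))).
apply: multivector_theta2.
by rewrite (ed_theta hf) (theta_multivector _ hP) (linZ (der_lin (ed_der hf))).
Qed.

Lemma graded_vform1 f : even_der f -> graded_vform 0 (vform1 f).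
Proof.
move=> hf; have lf := der_lin (ed_der hf); split.
- case=> [|S1 s] t c P Q /=.
    by case: t => [|? ?] /=; rewrite ?lf ?scaler0 ?addr0.
  by case: s => [|? ?] /=; rewrite scaler0 addr0.
- by case=> [|S1 [|? ?]] t x y P Q hP hQ /=; rewrite scaler0.
- move=> ds [|P [|? ?]] //; case: ds => [|x [|? ?]] //= _ hd.
  by rewrite big_seq1 addr0; apply: even_der_degree => //; exact: (hd 0%N).
Qed.

Lemma graded_vform_add e K1 K2 : graded_vform e K1 -> graded_vform e K2 ->
  graded_vform e (vform_add K1 K2).
Proof.
move=> [l1 s1 d1] [l2 s2 d2]; rewrite /vform_add; split.
- by move=> s t c P Q; rewrite l1 l2; mvring.
- by move=> s t x y P Q hP hQ; rewrite (s1 _ _ _ _ _ _ hP hQ) (s2 _ _ _ _ _ _ hP hQ) scalerDr.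
- move=> ds s sz hd x u ne; rewrite mvDE.
  by rewrite (d1 ds s sz hd _ _ ne) (d2 ds s sz hd _ _ ne) addr0.
Qed.

End VectorValuedForms.

(** * Omega-N structures *)

Section OmegaN.
Context {R : realType} {M : manifold R} {A : vbundle M} (L : lie_algebroid A).
Local Notation V := (mvect A).
Local Notation fn := (mvfun A).
Implicit Types (P Q S : V) (f g : smoothfun M) (X Y Z : sect A).

(* The Chevalley-Eilenberg differential of a 2-form, for an arbitrary anchor
   [r] and bracket [br] on sections. *)
Definition form_diff (r : sect A -> smoothfun M -> smoothfun M)
    (br : sect A -> sect A -> sect A) (a : sect A -> sect A -> smoothfun M) X Y Z :=
  r X (a Y Z) - r Y (a X Z) + r Z (a X Y)
  - a (br X Y) Z + a (br X Z) Y - a (br Y Z) X.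

Lemma dA_two_form (a : sect A -> sect A -> smoothfun M) X Y Z :
  dA L (fun s => a s`_0 s`_1) [:: X; Y; Z] = form_diff (rho L) (lbracket L) a X Y Z.
Proof.
rewrite /dA /= !big_ord_recl !big_ord0 !big_mkcond /= !big_ord_recl !big_ord0 /=.
do 2 rewrite big_mkcond /= !big_ord_recl !big_ord0 /=.
by rewrite /form_diff /bump /= /omit /= !add0n !addn0 /= !add1n /=; ring.
Qed.

Section Forms.
Variables (a : sect A -> sect A -> smoothfun M) (C : V -> V -> V).
Hypotheses (ha : two_form a) (hC : is_form_ext a C).

(** On three sections the bracket is the differential of a for the anchor r and the bracket br that
    B induces. No Jacobi identity is asked of br, so the result applies to l_2 and equally to its
    deformation by N. *)
Lemma bracket3_form_ext k (B : V -> V -> V) r br : bider k B ->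
  (forall f g, B (fn f) (fn g) = 0) ->
  (forall X f, B (mvsect X) (fn f) = fn (r X f)) ->
  (forall X Y, B (mvsect X) (mvsect Y) = mvsect (br X Y)) ->
  (forall X Y Z, form_diff r br a X Y Z = 0) ->
  forall p q s P Q S, par p P -> par q Q -> par s S -> bracket3 C B p q s P Q S = 0.
Proof.
move=> hB Bff BXf BXX cl p q s P Q S; have hbC := bider_form_ext ha hC.
apply: (bracket3_eq0 hbC hB) => [f P'|//|X f|X Y|X Y Z].
- exact: (form_ext_funl hC).
- by exists (r X f).
- by exists (a X Y); exact: form_ext_sect2.
have BfX f U : B (fn f) (mvsect U) = fn (r U f).
  by rewrite (bd_sym hB (par_fun f) (par_sect U)) /= BXf.
rewrite /bracket3 /insert3 /= !BXX !(form_ext_sect2 hC) !BfX.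
by rewrite -[RHS](mvfun0 A) -(cl X Y Z) /form_diff -!(mvfunN, mvfunD); congr fn; ring.
Qed.

End Forms.
End OmegaN.

Section Corollary.
Context {R : realType} {M : manifold R} {A : vbundle M} (L : lie_algebroid A).
Local Notation V := (mvect A).
Local Notation fn := (mvfun A).
Implicit Types (f g : smoothfun M) (X Y Z : sect A).
Variables (N : sect A -> sect A) (a : sect A -> sect A -> smoothfun M).
Hypothesis hNa : omegaN L N a.

Let ha : two_form a := omegaN_form hNa.

Lemma omegaN_shift X Y : a X (N Y) = a (N X) Y.
Proof.
by rewrite (two_form_skew ha) -[a (N Y) X]/(form_twist N a Y X) -(omegaN_skew hNa).
Qed.

Lemma form_add_l X Y Z : a (X + Y) Z = a X Z + a Y Z.
Proof. by have := two_form_linear ha Z 1 X Y; rewrite scale1r mul1r. Qed.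

Lemma form_opp_l X Z : a (- X) Z = - a X Z.
Proof.
have E U : a (0 + U) Z = a 0 Z + a U Z by exact: form_add_l.
have a0 : a 0 Z = 0.
  by have := E 0; rewrite addr0 => /esym/eqP; rewrite -subr_eq0 addrK => /eqP.
by apply/eqP; rewrite -addr_eq0 -form_add_l addNr a0.
Qed.

Lemma two_form_twist : two_form (form_twist N a).
Proof.
split; last exact: (omegaN_skew hNa).
by move=> Y f X X'; rewrite /form_twist (omegaN_tensor hNa) (two_form_linear ha).
Qed.

Lemma omegaN_d2 X Y Z : form_diff (rho L) (lbracket L) a X Y Z = 0.
Proof. by rewrite -dA_two_form; exact: (omegaN_closed hNa). Qed.

Lemma omegaN_twist_d2 X Y Z :
  form_diff (rho L) (lbracket L) (form_twist N a) X Y Z = 0.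
Proof. by rewrite -dA_two_form; exact: (omegaN_twist_closed hNa). Qed.

(* d_N a = [i_N, d] a = i_N d a - 2 d (a_N). *)
Lemma omegaN_deformed_d2 X Y Z :
  form_diff (fun X => rho L (N X)) (fun X Y => lbracket L (N X) Y + lbracket L X (N Y)
    - N (lbracket L X Y)) a X Y Z = 0.
Proof.
have e1 := omegaN_d2 (N X) Y Z; have e2 := omegaN_d2 X (N Y) Z.
have e3 := omegaN_d2 X Y (N Z); have e4 := omegaN_twist_d2 X Y Z.
(* The first three zeros are the terms of i_N d a. The differential of a_N is subtracted twice
   because i_N a = 2 a_N, as a(X, N Y) = a(N X, Y). *)
rewrite -[RHS](_ : 0 + 0 + 0 - (0 + 0) = 0); last by ring.
rewrite -{1}e1 -{1}e2 -{1}e3 -{1}e4 -{1}e4 /form_diff /form_twist.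
by rewrite !(form_add_l, form_opp_l) !omegaN_shift; ring.
Qed.

End Corollary.

Theorem corollary2p7p8 (R : realType) (M : manifold R) (A : vbundle M)
    (L : lie_algebroid A) (SN : mvect A -> mvect A -> mvect A)
    (hSN : is_schouten L SN)
    (N : sect A -> sect A) (a : sect A -> sect A -> smoothfun M)
    (hNa : omegaN L N a)
    (* Necessary: evaluated on two sections X, Y, the conclusion amounts to
       torsion L N X Y *+ 2 = 0, which omegaN does not imply. *)
    (hN : forall X Y : sect A, torsion L N X Y = 0)
    (uN uN2 : mvect A -> mvect A) (ua uaN : mvect A -> mvect A -> mvect A)
    (huN : is_der_ext N uN) (huN2 : is_der_ext (N \o N) uN2)
    (hua : is_form_ext a ua) (huaN : is_form_ext (form_twist N a) uaN) :
  nijenhuis (vform2 (l2 SN))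
    (vform_add (vform1 uN) (vform2 ua))
    (vform_add (vform1 uN2) (vform2 uaN)).
Proof.
have ha := omegaN_form hNa; have haN := two_form_twist hNa.
have tN := omegaN_tensor hNa; have eN := even_der_ext huN; have eN2 := even_der_ext huN2.
have lN := der_lin (ed_der eN); have lN2 := der_lin (ed_der eN2).
have bm := bider_l2 hSN; have ba := bider_form_ext ha hua.
have baN := bider_form_ext haN huaN; have bmN := bider_twist eN bm.
have mff := l2_fun hSN; have mXf := l2_sect_fun hSN; have mXX := l2_sect hSN.
have NX := der_ext_sect huN; have N2X := der_ext_sect huN2.
have Nf := der_ext_fun huN; have N2f := der_ext_fun huN2.
have m0 P : l2 SN P 0 = 0 by exact: (lin0 (bd_linr bm P)).
have m0l P : l2 SN 0 P = 0 by exact: (lin0 (bd_linl bm P)).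
have mNff f g : twist uN (l2 SN) (mvfun A f) (mvfun A g) = 0.
  by rewrite /twist !Nf mff m0 m0l (lin0 lN) addr0 subr0.
have mNXf X f : twist uN (l2 SN) (mvsect X) (mvfun A f) = mvfun A (rho L (N X) f).
  by rewrite /twist NX Nf !mXf m0 Nf addr0 subr0.
have mNXX X Y : twist uN (l2 SN) (mvsect X) (mvsect Y) =
    mvsect (lbracket L (N X) Y + lbracket L X (N Y) - N (lbracket L X Y)).
  by rewrite /twist !NX !mXX NX !(mvsectD, mvsectN).
have am := bracket3_form_ext ha hua bm mff mXf mXX (omegaN_d2 hNa).
have aNm := bracket3_form_ext haN huaN bm mff mXf mXX (omegaN_twist_d2 hNa).
have amN := bracket3_form_ext ha hua bmN mNff mNXf mNXX (omegaN_deformed_d2 hNa).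
have add0 (K : seq (mvect A) -> mvect A) : vform_add K (fun=> 0) = K.
  by apply/funext => s; rewrite /vform_add addr0.
(* Since [a, l_2] = 0, only the binary form [N, l_2] survives, and the second bracket needs no more
   than [a, [N, l_2]] = 0. *)
have RNm : RN 0 1 (vform_add (vform1 uN) (vform2 ua)) (vform2 (l2 SN)) =
    vform2 (twist uN (l2 SN)).
  rewrite RN_addl; last by move=> P Q u; apply: vform2D; exact: bd_linl bm.
  by rewrite (RN12 _ eN bm) (RN22 _ ba bm am) add0.
split.
- exact: (graded_vform2 bm).
- by apply: graded_vform_add; [exact: graded_vform1|exact: (graded_vform2 ba)].
- by apply: graded_vform_add; [exact: graded_vform1|exact: (graded_vform2 baN)].
- rewrite RNm RN_addl; last by move=> P Q u; apply: vform2D; exact: bd_linl bmN.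
  rewrite (RN12 _ eN bmN) (RN22 _ ba bmN amN) add0.
  rewrite RN_addl; last by move=> P Q u; apply: vform2D; exact: bd_linl bm.
  rewrite (RN12 _ eN2 bm) (RN22 _ baN bm aNm) add0 => s; congr (vform2 _ s).
  apply/funext => P; apply/funext => Q; apply/eqP; rewrite -subr_eq0; apply/eqP.
  apply: (bd_eq0 (bider_sub (bider_twist eN bmN) (bider_twist eN2 bm))) => [f g|X f|X Y].
  + rewrite /twist !Nf !N2f !mff !m0 !m0l !(lin0 lN) !(lin0 lN2).
    by rewrite !(m0, m0l, addr0, subr0, lin0 lN).
  + rewrite {1}/twist NX Nf !mNXf (lin0 (bd_linr bmN _)) Nf /twist N2X N2f !mXf m0 N2f.
    by rewrite !(addr0, subr0) subrr.
  + rewrite {1}/twist !NX !mNXX NX /twist !N2X !mXX N2X /=.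
    (* After expansion the two sides differ by two copies of the torsion; its vanishing is
       transported to multivector fields, where values can be combined linearly. *)
    have := congr1 (@mvsect _ _ A) (hN X Y).
    rewrite /torsion !(linD tN, linN tN, mvsectD, mvsectN) => t.
    apply: mv_eq => x u; have := congr1 (fun P : mvect A => P x u) t.
    have -> : mvsect (0 : sect A) = 0.
      by apply: mv_eq => y [|b [|c v]] //=; rewrite linear0.
    by rewrite !(mvDE, mvNE, mv0E) => e; lra.
(* By arity: the unary part [N, N^2] and the ternary part [a, a_N] vanish on their own, and the
   binary part is [N, a_N] + [a, N^2], whose terms cancel each other. *)
- move=> s; rewrite RN_addr; last first.
    apply: vform_addD => P Q u; first exact: vform1D.
    by apply: vform2D; exact: bd_linl ba.
  rewrite RN_addl; last by move=> P Q u; exact: vform1D.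
  rewrite RN_addl; last by move=> P Q u; apply: vform2D; exact: bd_linl baN.
  rewrite (RN11 _ lN lN2); last first.
    move=> P; apply/eqP; rewrite -subr_eq0; apply/eqP.
    have dc := der_comm (ed_der eN) (ed_der eN2) (ed_parity eN) (ed_parity eN2).
    apply: (der0 dc _ _ P) => [f|X] /=.
      by rewrite Nf N2f (lin0 lN) (lin0 lN2) subrr.
    by rewrite NX !N2X NX subrr.
  rewrite (RN12 _ eN baN) (RN22 _ ba baN); last first.
    apply: (bracket3_eq0 ba baN) => [f P|f g|X f|X Y|X Y Z].
    - exact: (form_ext_funl hua).
    - exact: (form_ext_fun huaN).
    - by exists 0; rewrite (form_ext_fun huaN) mvfun0.
    - by exists (a X Y); exact: form_ext_sect2.
    - rewrite /bracket3 /insert3 /= !(form_ext_sect2 hua) !(form_ext_sect2 huaN).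
      by rewrite !(form_ext_funl hua) !(form_ext_funl huaN) !(oppr0, addr0).
  rewrite /vform_add add0r addr0.
  (* Between forms of degree 0 the bracket is antisymmetric. *)
  have -> : RN 0 0 (vform2 ua) (vform1 uN2) s = - RN 0 0 (vform1 uN2) (vform2 ua) s.
    by rewrite !RN0E opprB.
  rewrite (RN12 _ eN2 ba) addrC; apply/eqP; rewrite subr_eq0; apply/eqP.
  congr (vform2 _ s); apply/funext => P; apply/funext => Q.
  apply/eqP; rewrite -subr_eq0; apply/eqP.
  apply: (bd_eq0 (bider_sub (bider_twist eN baN) (bider_twist eN2 ba))) => [f g|X f|X Y].
  + rewrite /twist !Nf !N2f !(form_ext_fun hua, form_ext_fun huaN).
    rewrite !(form_ext_funl hua, form_ext_funl huaN) (lin0 lN) (lin0 lN2).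
    by rewrite !(addr0, subr0).
  + rewrite /twist !Nf !N2f !(form_ext_fun hua, form_ext_fun huaN).
    rewrite (lin0 (bd_linr ba _)) (lin0 (bd_linr baN _)) (lin0 lN) (lin0 lN2).
    by rewrite !(addr0, subr0).
  (* By [omegaN_shift] both sides equal 2 a(N (N X), Y). *)
  + rewrite /twist !NX !N2X !(form_ext_sect2 hua) !(form_ext_sect2 huaN) Nf N2f /form_twist /=.
    by rewrite !subr0 !(omegaN_shift hNa) subrr.
Qed.
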